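(* Let $k\in\mathbb{N}$ and let $\mu$ be the standard Gaussian measure on $\mathbb{R}^k$. For each $p\in\mathbb{R}_{>1}$ there is a constant $C_p\in\mathbb{R}_{>0}$ such that $$\int_{S^{n-1}(\sqrt n)}|g|\,d\bar\sigma_n\le C_p\left[\mathbb{E}_\mu(|g|^p)\right]^{1/p}\quad\text{for all } g\in L^p(\mathbb{R}^k,\mu)\text{ and } n\in\mathbb{N}_{>4(k+1)q},$$ where $q\in\mathbb{R}_{>0}$ is such that $\frac1p+\frac1q=1$. Furthermore, the constant may be taken as close to $1$ as desired if $n$ is large enough, with the threshold depending only on $p$ and the desired distance from $1$ (for the fixed $k$): for each $p\in\mathbb{R}_{>1}$ and $\epsilon\in\mathbb{R}_{>0}$ there is $n_p\in\mathbb{N}$ such that $$\int_{S^{n-1}(\sqrt n)}|g|\,d\bar\sigma_n\le(1+\epsilon)\left[\mathbb{E}_\mu(|g|^p)\right]^{1/p}\quad\text{for all } g\in L^p(\mathbb{R}^k,\mu)\text{ and } n\in\mathbb{N}_{>n_p}.$$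
   Context: $S^{n-1}(\sqrt n)$ is the sphere of radius $\sqrt n$ centered at the origin in $\mathbb{R}^n$, and $\bar\sigma_n$ is the unique rotation-invariant Borel probability measure on it. A function $g$ on $\mathbb{R}^k$ is regarded as a function on $\mathbb{R}^n$ ($n\ge k$) by composing with the projection onto the first $k$ coordinates. The standard Gaussian measure $\mu$ on $\mathbb{R}^k$ has mean zero and identity covariance, and $\mathbb{E}_\mu$ is expectation with respect to $\mu$. The dimension $k$ is fixed throughout; the constants $C_p$ and $n_p$ may depend on $k$. *)

(* Defs.v *)
From HB Require Import structures.
From mathcomp Require Import all_boot all_order all_algebra.
From mathcomp Require Import all_classical all_reals all_analysis.
Import Order.TTheory GRing.Theory Num.Theory.
Import numFieldNormedType.Exports.
Set Implicit Arguments.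
Unset Strict Implicit.
Unset Printing Implicit Defensive.
Local Open Scope classical_set_scope.
Local Open Scope ring_scope.

(* R^n is n.-tuple R with the library's product sigma-algebra, generated by
   the coordinate maps; as R is second countable, this is the Borel
   sigma-algebra of R^n. *)

Section gaussian.
Context {R : realType}.

Definition tuple_cons k (x : measurableTypeR R * k.-tuple R) : k.+1.-tuple R :=
  [tuple of x.1 :: x.2].

Lemma measurable_tuple_cons k : measurable_fun setT (@tuple_cons k).
Proof.
apply: (@measurable_cons _ _ (measurableTypeR R * k.-tuple R)%type R fst k snd).
- exact: measurable_fst.
- exact: measurable_snd.
Qed.

HB.instance Definition _ k :=
  isMeasurableFun.Build _ _ _ _ (@tuple_cons k) (@measurable_tuple_cons k).

(* The k-fold product of the standard normal distribution N(0, 1). *)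
Fixpoint std_gaussian (k : nat) : probability (k.-tuple R) R :=
  match k with
  | 0 => \d_([tuple] : 0.-tuple R)
  | k'.+1 => distribution (normal_prob (0 : R) 1 \x std_gaussian k')%E
                          (@tuple_cons k')
  end.

End gaussian.
Arguments std_gaussian R k : clear implicits.

Lemma std_gaussian_box (R : realType) (k : nat) (A : 'I_k -> set R) :
  (forall i, measurable (A i)) ->
  std_gaussian R k [set x | forall i, A i (tnth x i)] =
  (\prod_(i < k) normal_prob (0 : R) 1 (A i))%E.
Proof.
elim: k A => [|k IH] A mA.
  rewrite big_ord0 /= diracE mem_set//= => -[].
  by [].
rewrite big_ord_recl -IH; last by move=> i; exact: mA.
rewrite /= /distribution /pushforward /=.
rewrite (_ : _ @^-1` _ = A ord0 `*`
    [set x : k.-tuple R | forall i, A (lift ord0 i) (tnth x i)]); last first.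
  apply/seteqP; split => -[a x] /=.
    by move=> h; split=> [|i]; [exact: (h ord0)|have := h (lift ord0 i); rewrite tnthS].
  move=> [Aa Ax] i; have [j ->|->//] := unliftP ord0 i.
  by rewrite tnthS; exact: Ax.
rewrite product_measure1E//; first exact: mA.
rewrite (_ : [set _ | _] =
    \bigcap_(i in [set: 'I_k]) ((@tnth k R ^~ i) @^-1` A (lift ord0 i))).
  apply: fin_bigcap_measurable => // i _; rewrite -[X in measurable X]setTI.
  by apply: (@measurable_tnth _ R k i) => //; exact: mA.
by apply/seteqP; split => x /= h i; [move=> _|]; exact: h.
Qed.

Section sphere.
Context {R : realType}.
Implicit Types n k : nat.

Definition euclidean_norm n (x : n.-tuple R) : R :=
  Num.sqrt (\sum_(i < n) tnth x i ^+ 2).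

Definition sphere n (r : R) : set (n.-tuple R) :=
  [set x | euclidean_norm x = r].
Arguments sphere n r : clear implicits.

Definition is_rotation n (U : 'M[R]_n) : Prop := U^T *m U = 1%:M /\ \det U = 1.

Definition mx_act n (U : 'M[R]_n) (x : n.-tuple R) : n.-tuple R :=
  [tuple \sum_(j < n) U i j * tnth x j | i < n].

(* A measure on the sphere is encoded as a measure on R^n carried by it. For
   n >= 2 and 0 <= r exactly one probability measure satisfies this. *)
Definition is_uniform_on_sphere n (r : R) (sigma : probability (n.-tuple R) R)
    : Prop :=
  sigma (sphere n r) = 1%E /\
  forall U : 'M[R]_n, is_rotation U ->
    forall A : set (n.-tuple R), measurable A ->
      sigma (mx_act U @^-1` A) = sigma A.

(* Coordinates of index at least n are read as 0; there are none if k <= n. *)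
Definition first_coords k n (x : n.-tuple R) : k.-tuple R :=
  [tuple x`_i | i < k].

End sphere.
Arguments sphere {R} n r.

(* Main.v *)
(* Let X be a standard Gaussian vector in R^n. A rotation-invariant probability
   measure on a sphere gives to the cap {y | <x, y> > c} a mass independent of
   the centre x, and so does the law of r X / |X|. Two such measures coincide:
   exchanging the order of integration shows that their caps have the same mass,
   and comparing them on pairs of nearby points shows that they agree on
   orthants. The projection to R^k of the law of sqrt n X / |X| is then computed
   by Tonelli, translations and scalings only: it has density
   f_n = A_n (1 - |w|^2 / n)_+^((n - k) / 2 - 1) e^(|w|^2 / 2) with respect to the
   Gaussian measure of R^k, with A_n the normalization factor. By Hoelder the
   integral of |g| is at most |g|_p |f_n|_q. Finally
   1 - |w|^4 / n <= f_n / A_n <= e^((k + 2) |w|^2 / (2 n)) bounds A_n and |f_n|_q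
   by explicit quantities that tend to 1. *)
Require Import Defs.
From HB Require Import structures.
From mathcomp Require Import all_boot all_order all_algebra.
From mathcomp Require Import all_classical all_reals all_analysis.
From mathcomp Require Import measurable_realfun.
From mathcomp Require Import ring lra.
Import Order.TTheory GRing.Theory Num.Theory.
Import numFieldNormedType.Exports.
Set Implicit Arguments.
Unset Strict Implicit.
Unset Printing Implicit Defensive.
Local Open Scope classical_set_scope.
Local Open Scope ring_scope.

(** * One-dimensional substitutions and planar rotations *)

(** No rotation of [R^n] is ever applied to the Gaussian measure. The mass of a cap involves only
    the pair [(<x, X>, |X|^2)], whose law is found by rotating one plane at a time, and a rotation
    of the plane is made of affine substitutions in one variable.

    Caps are not stable under intersection, so equality on caps does not extend to all sets by a
    pi-system argument. Positivity replaces it: the mass of an arbitrarily small cap is positive and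
    can be cancelled when a region is compared with a slightly larger one.

    The factor [A_n] is not computed. It is first an element of [\bar R]; testing the projection on
    the constant function 1 shows that it is finite and is the inverse of the integral of
    [f_n / A_n].

    The number [k + 2] comes from [(n - k) / 2 - 1 = (n - (k + 2)) / 2]. Thus [(f_n / A_n)^q] is
    dominated by [e^(b |w|^2 / 2)] with [b = (k + 2) q / n], integrable for [b < 1], and
    [n > 4 (k + 1) q] ensures this. Each such [n] gets its own constant; as the bounds on these tend
    to 1, only finitely many [n] remain to be dominated by [C_p]. *)

Section affine_substitution.
Context {R : realType}.
Local Notation mu := (@lebesgue_measure R).

Lemma measurable_affine (c b : R) :
  measurable_fun [set: measurableTypeR R]
    ((fun x => c * x + b) : _ -> measurableTypeR R).
Proof. by apply: measurable_funD => //; exact: mulrl_measurable. Qed.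

(** By uniqueness of Lebesgue measure: [c] times the image of [mu] under [x -> c x + b] gives every
    interval its length. *)
Lemma ge0_integral_affine_pos (c b : R) (f : R -> \bar R) : 0 < c ->
  measurable_fun [set: R] f -> (forall x, (0 <= f x)%E) ->
  (\int[mu]_x f (c * x + b)%R = c^-1%:E * \int[mu]_x f x)%E.
Proof.
move=> c0 mf f0.
pose phi := (fun x => c * x + b) : measurableTypeR R -> measurableTypeR R.
have mphi : measurable_fun setT phi by exact: measurable_affine.
pose phim := HB.pack_for {mfun measurableTypeR R >-> measurableTypeR R} phi
  (isMeasurableFun.Build _ _ _ _ phi mphi).
have cV : 0 <= c^-1 by rewrite invr_ge0 ltW.
have -> : (\int[mu]_x f (c * x + b)%R = \int[pushforward mu phim]_x f x)%E.
  by rewrite ge0_integral_pushforward.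
have -> : (c^-1%:E * \int[mu]_x f x = \int[mscale (NngNum cV) mu]_x f x)%E.
  by rewrite ge0_integral_mscale.
apply: eq_measure_integral => A mA _.
have : (mscale (NngNum (ltW c0)) (pushforward mu phim) A = mu A).
  symmetry; apply: (@lebesgue_measure_unique R
    (mscale (NngNum (ltW c0)) (pushforward mu phim))) => // _ [[u v]] _ <- /=.
  rewrite /mscale /= /pushforward /= lebesgue_measure_itv /=.
  rewrite (_ : phi @^-1` _ = `](u - b) / c, (v - b) / c]%classic); last first.
    apply/seteqP; split => x /=; rewrite !in_itv /= /phi
      ltr_pdivrMr// ler_pdivlMr// ltrBlDr lerBrDr (mulrC x)//.
  rewrite lebesgue_measure_itv /= !lte_fin ltr_pM2r ?invr_gt0// ltrD2r.
  case: ifPn; rewrite ?mule0// => _.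
  by rewrite -!EFinB -EFinM; congr (_%:E); field; rewrite gt_eqF.
rewrite /mscale /= => E; transitivity (c^-1%:E * (c%:E * mu (phi @^-1` A)))%E.
  by rewrite muleA -EFinM mulVf ?gt_eqF// mul1e.
by congr (_ * _)%E; exact: E.
Qed.

Lemma ge0_integral_affine (c b : R) (f : R -> \bar R) : c != 0 ->
  measurable_fun [set: R] f -> (forall x, (0 <= f x)%E) ->
  (\int[mu]_x f (c * x + b)%R = `|c|^-1%:E * \int[mu]_x f x)%E.
Proof.
move=> c0 mf f0; have [c_gt0|c_lt0] := ltP 0 c.
  by rewrite ge0_integral_affine_pos// gtr0_norm.
have c_neg : c < 0 by rewrite lt_neqAle c0.
rewrite ltr0_norm//.
have -> : (\int[mu]_x f x = \int[mu]_x f (- x)%R)%E.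
  transitivity (\int[pushforward mu (-%R : _ -> measurableTypeR R)]_x f x)%E; last first.
    by rewrite ge0_integral_pushforward.
  by apply: eq_measure_integral => A mA _; exact/esym/lebesgue_measureN.
have mfN : measurable_fun setT (f \o -%R) by exact: measurableT_comp.
rewrite -(@ge0_integral_affine_pos (- c) (- b) (f \o -%R)) ?oppr_gt0//=.
by apply: eq_integral => x _; congr f; ring.
Qed.

End affine_substitution.

Section normal_integral.
Context {R : realType}.
Local Notation mu := (@lebesgue_measure R).
Local Notation N01 := (@normal_prob R 0 1).

(** The change of variables holds with the Radon-Nikodym derivative, which equals [normal_pdf]
    almost everywhere because both have the same integral over every measurable set. *)
Lemma ge0_integral_normal (f : R -> \bar R) :
  measurable_fun [set: R] f -> (forall x, (0 <= f x)%E) ->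
  (\int[N01]_x f x = \int[mu]_x (f x * (normal_pdf 0 1 x)%:E))%E.
Proof.
move=> mf f0.
have dom := @normal_prob_dominates R 0 1.
rewrite -(Radon_Nikodym_SigmaFinite.change_of_variables dom)//.
have mpdf : measurable_fun [set: R] (fun x => (normal_pdf 0 1 x)%:E).
  by apply/measurable_EFinP; exact: measurable_normal_pdf.
have iRN := Radon_Nikodym_SigmaFinite.f_integrable dom.
apply: ae_eq_integral => //.
- by apply: emeasurable_funM => //; exact: measurable_int iRN.
- exact: emeasurable_funM.
- apply: ae_eqe_mul2l; apply: integral_ae_eq => // E _ mE.
  by rewrite -Radon_Nikodym_SigmaFinite.f_integral.
Qed.

Lemma normal_pdf01E (x : R) :
  normal_pdf 0 1 x = normal_peak 1 * expR (- (x ^+ 2 / 2)).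
Proof.
by rewrite normal_pdfE ?oner_eq0// /normal_fun subr0 expr1n mulNr.
Qed.

End normal_integral.

Ltac measurable_tac := repeat first
  [ assumption
  | match goal with
    | |- measurable_fun _ (fun x => x) => exact: measurable_id
    | |- measurable_fun _ (fun x => (_, _)) => apply: measurable_fun_pair
    | |- measurable_fun _ (fun x => fst x) => exact: measurable_fst
    | |- measurable_fun _ (fun x => snd x) => exact: measurable_snd
    | |- measurable_fun _ (fun x => fst _) =>
      apply: (measurableT_comp measurable_fst)
    | |- measurable_fun _ (fun x => snd _) =>
      apply: (measurableT_comp measurable_snd)
    | |- measurable_fun _ (fun x => EFin _) => apply/measurable_EFinP
    | |- measurable_fun _ (fun x => expR _) =>
      apply: (measurableT_comp (@measurable_expR _))
    | |- measurable_fun _ (fun x => _ ^+ _) => apply: measurable_funX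
    | |- measurable_fun _ (fun x => (_ - _)%R) => apply: measurable_funB
    | |- measurable_fun _ (fun x => (_ + _)%R) => apply: measurable_funD
    | |- measurable_fun _ (fun x => (- _)%R) => apply: measurable_funN
    | |- measurable_fun _ (fun x => (_ * _)%R) => apply: measurable_funM
    | |- measurable_fun _ (fun x => (_ * _)%E) => apply: emeasurable_funM
    end
  | exact: measurable_cst ].

Section normal_plane.
Context {R : realType}.
Local Notation mu := (@lebesgue_measure R).
Local Notation N01 := (@normal_prob R 0 1).

Lemma ge0_integral_normalE (f : R -> \bar R) :
  measurable_fun [set: R] f -> (forall x, (0 <= f x)%E) ->
  (\int[N01]_x f x =
   (normal_peak 1)%:E * \int[mu]_x (f x * (expR (- (x ^+ 2 / 2)))%:E))%E.
Proof.
move=> mf f0; rewrite ge0_integral_normal// -ge0_integralZl//.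
- by apply: eq_integral => x _; rewrite normal_pdf01E EFinM muleCA.
- by apply: emeasurable_funM => //; apply/measurable_EFinP; measurable_tac.
- by move=> x _; rewrite mule_ge0// lee_fin expR_ge0.
- by rewrite lee_fin normal_peak_ge0.
Qed.

(* The substitutions [u = c a + s b] at fixed [b] and then [b = c v + s u] at
   fixed [u] turn [(c a + s b, a^2 + b^2)] into [(u, u^2 + v^2)]. *)
Lemma lebesgue_plane_rotation (c s : R) (F : R * R -> \bar R) :
  c ^+ 2 + s ^+ 2 = 1 -> measurable_fun [set: R * R] F ->
  (forall x, (0 <= F x)%E) ->
  (\int[mu]_a \int[mu]_b F (c * a + s * b, a ^+ 2 + b ^+ 2)%R =
   \int[mu]_a \int[mu]_b F (a, a ^+ 2 + b ^+ 2)%R)%E.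
Proof.
move=> cs mF F0.
have exch (g : R * R -> R * R) : measurable_fun setT g ->
    (\int[mu]_a \int[mu]_b F (g (a, b)) =
     \int[mu]_b \int[mu]_a F (g (a, b)))%E.
  move=> mg; apply: (@fubini_tonelli _ _ _ _ R mu mu (F \o g)).
    exact: measurableT_comp.
  by move=> x; exact: F0.
(* The substitution in [a] divides by [c]. If [c = 0], then [s] is 1 or -1, and an exchange of [a]
   and [b] with a possible reflection is enough. *)
have [c0|c0] := eqVneq c 0.
  have s2 : s ^+ 2 = 1 by rewrite -cs c0; ring.
  have s1 : `|s| = 1.
    by apply/eqP; rewrite -(@eqrXn2 _ 2)// expr1n -normrX s2 normr1.
  have := exch (fun x => (x.1, x.1 ^+ 2 + x.2 ^+ 2)).
  move=> ->; last by measurable_tac.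
  apply: eq_integral => a _ /=.
  rewrite -[RHS]mul1e -[in X in (X * _)%E]invr1 -s1.
  rewrite -(@ge0_integral_affine _ s 0 (fun x => F (x, x ^+ 2 + a ^+ 2)))//.
  - apply: eq_integral => b _; rewrite c0 mul0r add0r addr0 exprMn s2 mul1r.
    by rewrite addrC.
  - by rewrite -normr_gt0 s1.
  - by apply: (measurableT_comp mF); measurable_tac.
rewrite (exch (fun x => (c * x.1 + s * x.2, x.1 ^+ 2 + x.2 ^+ 2)));
  last by measurable_tac.
(* The arguments of [F] in terms of [(u, b)], after solving [u = c a + s b] for [a]. *)
pose g (x : R * R) := (x.1, ((x.1 - s * x.2) / c) ^+ 2 + x.2 ^+ 2).
have mg : measurable_fun setT g by rewrite /g; measurable_tac.
have mFg : measurable_fun setT (F \o g) by exact: measurableT_comp.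
have cV0 : (0 <= (`|c|^-1)%:E)%E by rewrite lee_fin invr_ge0.
(* The Jacobian [|c|^-1] produced here is exactly what the second substitution, of slope [c] in [v],
   absorbs. *)
transitivity (\int[mu]_b (`|c|^-1%:E * \int[mu]_u F (g (u, b))))%E.
  apply: eq_integral => b _ /=.
  rewrite -(@ge0_integral_affine _ c (s * b) (fun u => F (g (u, b))))//.
  - apply: eq_integral => a _; congr F; rewrite /g /=; congr (_, _).
    by congr (_ ^+ 2 + _); field.
  - exact: (measurableT_comp mFg (pair2_measurable b)).
rewrite ge0_integralZl//; last 2 first.
  - by apply: (@measurable_fun_fubini_tonelli_G _ _ _ _ R mu (F \o g)) => // x; exact: F0.
  - by move=> b _; exact: integral_ge0.
rewrite -(exch g)// -ge0_integralZl//; last 2 first.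
  - by apply: (@measurable_fun_fubini_tonelli_F _ _ _ _ R mu (F \o g)) => // x; exact: F0.
  - by move=> b _; exact: integral_ge0.
apply: eq_integral => u _.
rewrite -(@ge0_integral_affine _ c (s * u) (fun b => F (g (u, b))))//.
- apply: eq_integral => v _; congr F; rewrite /g /=; congr (_, _).
  have -> : u - s * (c * v + s * u) = c * (c * u - s * v).
    rewrite -[u in u - _]mul1r -cs; ring.
  rewrite mulrC mulKf//.
  rewrite (_ : _ + _ = (c ^+ 2 + s ^+ 2) * (u ^+ 2 + v ^+ 2)); last by ring.
  by rewrite cs mul1r.
- exact: (measurableT_comp mFg (pair1_measurable u)).
Qed.

(** The Gaussian density of the plane is a function of [a^2 + b^2], the second argument of [F].
    Absorbed into [F], it leaves the statement for Lebesgue measure. *)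
Lemma normal_plane_rotation (c s : R) (F : R * R -> \bar R) :
  c ^+ 2 + s ^+ 2 = 1 -> measurable_fun [set: R * R] F ->
  (forall x, (0 <= F x)%E) ->
  (\int[N01]_a \int[N01]_b F (c * a + s * b, a ^+ 2 + b ^+ 2)%R =
   \int[N01]_a \int[N01]_b F (a, a ^+ 2 + b ^+ 2)%R)%E.
Proof.
move=> cs mF F0.
pose E (x : R * R) := (F x * (expR (- (x.2 / 2)))%:E)%E.
have mE : measurable_fun setT E.
  by apply: emeasurable_funM => //; apply/measurable_EFinP; measurable_tac.
have E0 x : (0 <= E x)%E by rewrite mule_ge0// lee_fin expR_ge0.
pose C : \bar R := (normal_peak 1)%:E.
have C0 : (0 <= C)%E by rewrite lee_fin normal_peak_ge0.
have normal2 (h : R * R -> R) : measurable_fun setT h ->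
    (\int[N01]_a \int[N01]_b F (h (a, b), a ^+ 2 + b ^+ 2)%R =
     C * (C * \int[mu]_a \int[mu]_b E (h (a, b), a ^+ 2 + b ^+ 2)%R))%E.
  move=> mh.
  pose k (x : R * R) := (h x, x.1 ^+ 2 + x.2 ^+ 2).
  have mk : measurable_fun setT k by rewrite /k; measurable_tac.
  have mFk : measurable_fun setT (F \o k) by exact: measurableT_comp.
  have mEk : measurable_fun setT (E \o k) by exact: measurableT_comp.
  rewrite ge0_integral_normalE; last 2 first.
    - by apply: (@measurable_fun_fubini_tonelli_F _ _ _ _ R N01 (F \o k)) => // x; exact: F0.
    - by move=> a; exact: integral_ge0.
  congr (_ * _)%E; rewrite -ge0_integralZl//; last 2 first.
    - by apply: (@measurable_fun_fubini_tonelli_F _ _ _ _ R mu (E \o k)) => // x; exact: E0.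
    - by move=> a _; exact: integral_ge0.
  apply: eq_integral => a _.
  have mFa : measurable_fun setT (fun b => F (k (a, b))).
    exact: (measurableT_comp mFk (pair1_measurable a)).
  rewrite ge0_integral_normalE// -muleA; congr (_ * _)%E.
  rewrite -ge0_integralZr//; last 2 first.
  - apply: emeasurable_funM => //; apply/measurable_EFinP; measurable_tac.
  - by move=> x _; rewrite mule_ge0// lee_fin expR_ge0.
  apply: eq_integral => b _; rewrite /E /= -muleA; congr (_ * _)%E.
  by rewrite -EFinM -expRD; congr (expR _)%:E; field.
have mrot : measurable_fun setT (fun x : R * R => c * x.1 + s * x.2).
  by measurable_tac.
have /= -> := normal2 _ mrot; have /= -> := normal2 _ measurable_fst.
by rewrite lebesgue_plane_rotation.
Qed.

End normal_plane.

(** * Laws of linear forms and norms of Gaussian vectors *)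

Section measurable_real.
Context {R : realType}.

Lemma measurable_sqrt : measurable_fun [set: R] (@Num.sqrt R).
Proof. by apply: continuous_measurable_fun; exact: sqrt_continuous. Qed.

Lemma measurable_inv : measurable_fun [set: R] (@GRing.inv R).
Proof.
(* This formula also holds at 0, where the inverse is 0 by convention. *)
rewrite (_ : @GRing.inv R = fun x => x * (x ^+ 2) `^ (-1)); last first.
  apply/funext => x; rewrite powR_inv1 ?sqr_ge0//.
  by have [->|x0] := eqVneq x 0; [rewrite invr0 mul0r|field].
apply: measurable_funM => //.
apply: (measurableT_comp (@measurable_powR R (-1))).
exact: exprn_measurable.
Qed.

End measurable_real.

Section euclid.
Context {R : realType}.

Definition dot n (x y : n.-tuple R) : R := \sum_(i < n) tnth x i * tnth y i.
Definition sqnorm n (x : n.-tuple R) : R := \sum_(i < n) tnth x i ^+ 2.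
Definition scale_tuple n (c : R) (x : n.-tuple R) : n.-tuple R :=
  [tuple c * tnth x i | i < n].

Lemma sqnorm_ge0 n (x : n.-tuple R) : 0 <= sqnorm x.
Proof. by apply: sumr_ge0 => i _; exact: sqr_ge0. Qed.

Lemma sqnorm0 (x : 0.-tuple R) : sqnorm x = 0.
Proof. by rewrite /sqnorm big_ord0. Qed.

Lemma dot_cons n a b (x y : n.-tuple R) :
  dot (tuple_cons (a, x)) (tuple_cons (b, y)) = a * b + dot x y.
Proof.
rewrite /dot big_ord_recl /=; congr (_ + _).
by apply: eq_bigr => i _; rewrite !tnthS.
Qed.

Lemma sqnorm_cons n a (x : n.-tuple R) :
  sqnorm (tuple_cons (a, x)) = a ^+ 2 + sqnorm x.
Proof.
rewrite /sqnorm big_ord_recl /=; congr (_ + _).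
by apply: eq_bigr => i _; rewrite !tnthS.
Qed.

Lemma sqnorm_scale n c (x : n.-tuple R) :
  sqnorm (scale_tuple c x) = c ^+ 2 * sqnorm x.
Proof.
rewrite /sqnorm big_distrr/=; apply: eq_bigr => i _.
by rewrite tnth_mktuple exprMn.
Qed.

Lemma scale_cons n c a (x : n.-tuple R) :
  scale_tuple c (tuple_cons (a, x)) = tuple_cons (c * a, scale_tuple c x).
Proof.
apply: eq_from_tnth => i; rewrite tnth_mktuple.
have [j ->|->] := unliftP ord0 i; last by [].
by rewrite !tnthS tnth_mktuple.
Qed.

Lemma tuple_consE n (x : n.+1.-tuple R) :
  tuple_cons (thead x, [tuple of behead x]) = x.
Proof. by rewrite [RHS]tuple_eta; apply: val_inj. Qed.

Lemma first_coords_cons k m a (x : (k + m).-tuple R) :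
  @first_coords R k.+1 (k.+1 + m) (tuple_cons (a, x)) =
  tuple_cons (a, first_coords k x).
Proof.
apply: eq_from_tnth => i; rewrite tnth_mktuple.
have [j ->|->] := unliftP ord0 i; last by [].
by rewrite !tnthS tnth_mktuple.
Qed.

Lemma measurable_dot n (x : n.-tuple R) : measurable_fun setT (dot x).
Proof.
apply: measurable_sum => i; apply: measurable_funM => //.
exact: measurable_tnth.
Qed.

Lemma measurable_sqnorm n : measurable_fun setT (@sqnorm n).
Proof.
apply: measurable_sum => i; apply: measurable_funX.
exact: measurable_tnth.
Qed.

Lemma measurable_scale_tuple n : measurable_fun setT
  (fun x : R * n.-tuple R => scale_tuple x.1 x.2).
Proof.
apply/measurable_fun_tnthP => i /=.
rewrite (_ : _ \o _ = fun x : R * n.-tuple R => x.1 * tnth x.2 i); last first.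
  by apply/funext => x /=; rewrite tnth_mktuple.
apply: measurable_funM => //.
exact: (measurableT_comp (measurable_tnth i)).
Qed.

Lemma measurable_first_coords k n :
  measurable_fun setT (@first_coords R k n).
Proof.
apply/measurable_fun_tnthP => i /=.
rewrite (_ : _ \o _ = fun x : n.-tuple R => x`_i); last first.
  by apply/funext => x /=; rewrite tnth_mktuple.
have [ni|ni] := leqP n i.
  rewrite (_ : (fun x => _) = cst 0)//.
  by apply/funext => x; rewrite nth_default ?size_tuple.
rewrite (_ : (fun x => _) = @tnth n R ^~ (Ordinal ni)).
  exact: measurable_tnth.
by apply/funext => x; rewrite (tnth_nth 0).
Qed.

End euclid.

Section partial_integral.
Context d1 d2 (T1 : measurableType d1) (T2 : measurableType d2) (R : realType).
Variable m2 : {sigma_finite_measure set T2 -> \bar R}.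

Lemma measurable_integral_snd (F : T1 * T2 -> \bar R) :
  measurable_fun setT F -> (forall x, (0 <= F x)%E) ->
  measurable_fun setT (fun x => \int[m2]_y F (x, y))%E.
Proof. by move=> mF F0; exact: measurable_fun_fubini_tonelli_F. Qed.

End partial_integral.

Section integral_scale.
Context d (T : measurableType d) (R : realType).
Variable m : {measure set T -> \bar R}.

Lemma ge0_integralTZl (k : \bar R) (F : T -> \bar R) :
  measurable_fun setT F -> (forall x, (0 <= F x)%E) -> (0 <= k)%E ->
  (\int[m]_x (k * F x) = k * \int[m]_x F x)%E.
Proof. by move=> mF F0 k0; rewrite ge0_integralZl. Qed.

Lemma ge0_integralTZr (k : \bar R) (F : T -> \bar R) :
  measurable_fun setT F -> (forall x, (0 <= F x)%E) -> (0 <= k)%E ->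
  (\int[m]_x (F x * k) = (\int[m]_x F x) * k)%E.
Proof. by move=> mF F0 k0; rewrite ge0_integralZr. Qed.

End integral_scale.

Section gaussian_cons.
Context {R : realType}.
Local Notation mu := (@lebesgue_measure R).
Local Notation N01 := (@normal_prob R 0 1).
Local Notation G := (std_gaussian R).

Lemma integral_gaussian0 (F : 0.-tuple R -> \bar R) :
  (\int[G 0]_x F x = F [tuple])%E.
Proof.
have -> : F = cst (F [tuple]) by apply/funext => x; rewrite (tuple0 x).
by rewrite integral_dirac// diracE mem_set// mul1e.
Qed.

Lemma integral_gaussian_cons k (F : k.+1.-tuple R -> \bar R) :
  measurable_fun setT F -> (forall x, (0 <= F x)%E) ->
  (\int[G k.+1]_x F x = \int[N01]_a \int[G k]_y F (tuple_cons (a, y)))%E.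
Proof.
move=> mF F0; rewrite /std_gaussian -/(std_gaussian R k).
rewrite (@ge0_integral_distribution _ _ _ _ _ _ (@tuple_cons R k))//.
apply: (@fubini_tonelli1 _ _ _ _ R N01 (G k) (F \o @tuple_cons R k)).
  exact: (measurableT_comp mF (@measurable_tuple_cons R k)).
by move=> x; exact: F0.
Qed.

End gaussian_cons.

Section gaussian_laws.
Context {R : realType}.
Local Notation mu := (@lebesgue_measure R).
Local Notation N01 := (@normal_prob R 0 1).
Local Notation G := (std_gaussian R).

Lemma measurable_tuple_consl k (a : R) :
  measurable_fun setT (fun y : k.-tuple R => tuple_cons (a, y)).
Proof. exact: (measurableT_comp (@measurable_tuple_cons R k) (pair1_measurable a)). Qed.

Lemma measurable_dot_sqnorm k (x : k.-tuple R) :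
  measurable_fun setT (fun X => (dot x X, sqnorm X)).
Proof.
by apply: measurable_fun_pair; [exact: measurable_dot|exact: measurable_sqnorm].
Qed.

Lemma normal_opp (f : R -> \bar R) :
  measurable_fun setT f -> (forall x, (0 <= f x)%E) ->
  (\int[N01]_x f (- x)%R = \int[N01]_x f x)%E.
Proof.
move=> mf f0.
rewrite ge0_integral_normalE//; last by apply: measurableT_comp.
rewrite ge0_integral_normalE//; congr (_ * _)%E.
pose g x := (f x * (expR (- (x ^+ 2 / 2)))%:E)%E.
have mg : measurable_fun setT g by rewrite /g; measurable_tac.
have g0 x : (0 <= g x)%E by rewrite mule_ge0// lee_fin expR_ge0.
have m1 : -1 != 0 :> R by rewrite oppr_eq0 oner_eq0.
have := @ge0_integral_affine R (-1) 0 g m1 mg g0.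
rewrite normrN1 invr1 mul1e => <-.
by apply: eq_integral => x _; rewrite /g addr0 mulN1r sqrrN.
Qed.

(* The law of [(<x, X>, |X|^2)] depends on [x] through [|x|] only. Peeling off
   one coordinate leaves [x_0 X_0 + |x'| X_1], a rotation of a plane. *)
Lemma gaussian_dot k (x : k.+1.-tuple R) (F : R * R -> \bar R) :
  measurable_fun setT F -> (forall x, (0 <= F x)%E) ->
  (\int[G k.+1]_X F (dot x X, sqnorm X) =
   \int[N01]_a \int[G k]_Z
     F (Num.sqrt (sqnorm x) * a, a ^+ 2 + sqnorm Z)%R)%E.
Proof.
elim: k x F => [|k IH] x F mF F0.
  rewrite integral_gaussian_cons; [|exact: (measurableT_comp mF (measurable_dot_sqnorm x))|by []].
  under eq_integral do rewrite integral_gaussian0.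
  under [RHS]eq_integral do rewrite integral_gaussian0.
  rewrite -(tuple_consE x) (tuple0 [tuple of behead x]) sqnorm_cons sqnorm0.
  rewrite addr0 sqrtr_sqr; set x0 := thead x.
  under eq_integral do rewrite dot_cons sqnorm_cons sqnorm0 addr0
    /dot big_ord0 addr0.
  under [RHS]eq_integral do rewrite addr0.
  have [x0_ge0|/ltW x0_le0] := leP 0 x0; first by rewrite ger0_norm.
  rewrite ler0_norm// -normal_opp//.
  - by apply: eq_integral => a _; rewrite mulrN mulNr sqrrN.
  - by apply: (measurableT_comp mF); measurable_tac.
rewrite integral_gaussian_cons; [|exact: (measurableT_comp mF (measurable_dot_sqnorm x))|by []].
rewrite -(tuple_consE x); set x0 := thead x; set x' := [tuple of behead x].
set r := Num.sqrt _; pose r' := Num.sqrt (sqnorm x').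
have r2 : r ^+ 2 = x0 ^+ 2 + r' ^+ 2.
  by rewrite !sqr_sqrtr ?sqnorm_ge0// sqnorm_cons.
(* The angle of the vector [(x0, r')]; if [r = 0], both entries vanish and any angle serves. *)
have [c [s [cs x0E r'E]]] : exists c s : R, [/\ c ^+ 2 + s ^+ 2 = 1,
    x0 = r * c & r' = r * s].
  have [r0|r0] := eqVneq r 0.
    have := sqr_ge0 x0; have := sqr_ge0 r'; rewrite r0 expr0n/= in r2.
    move=> h1 h2; exists 1, 0; split; [by ring| |]; rewrite r0 mul0r.
      by apply/eqP; rewrite -sqrf_eq0 eq_le h2 andbT; lra.
    by apply/eqP; rewrite -sqrf_eq0 eq_le h1 andbT; lra.
  exists (x0 / r), (r' / r); split; last 2 first.
  - by rewrite mulrCA divff// mulr1.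
  - by rewrite mulrCA divff// mulr1.
  by rewrite !expr_div_n -mulrDl -r2 divff// sqrf_eq0.
pose F2 (x : R * R) : \bar R := (\int[G k]_z F (r * x.1, x.2 + sqnorm z)%R)%E.
pose h (x : (R * R) * k.-tuple R) := (r * x.1.1, x.1.2 + sqnorm x.2).
have mh : measurable_fun setT h.
  apply: measurable_fun_pair; first by measurable_tac.
  apply: measurable_funD; first by measurable_tac.
  exact: (measurableT_comp (@measurable_sqnorm R k)).
have mF2 : measurable_fun setT F2.
  apply: (@measurable_integral_snd _ _ _ _ R (G k) (F \o h)).
    exact: measurableT_comp.
  by move=> z; exact: F0.
have F20 z : (0 <= F2 z)%E by exact: integral_ge0.
(* By induction the last [k + 1] coordinates enter the linear form through a single normal variable
   [b] with coefficient [r'], and [x0 a + r' b = r (c a + s b)]. *)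
transitivity (\int[N01]_a \int[N01]_b F2 (c * a + s * b, a ^+ 2 + b ^+ 2)%R)%E.
  apply: eq_integral => a _.
  under eq_integral do rewrite dot_cons sqnorm_cons.
  pose Fa (x : R * R) := F (x0 * a + x.1, a ^+ 2 + x.2).
  have mFa : measurable_fun setT Fa.
    by apply: (measurableT_comp mF); measurable_tac.
  rewrite (IH x' Fa mFa (fun=> F0 _)); apply: eq_integral => b _.
  apply: eq_integral => z _; rewrite /Fa /= -/r' x0E r'E.
  by rewrite mulrDr !mulrA addrA.
rewrite normal_plane_rotation//; apply: eq_integral => a _.
rewrite integral_gaussian_cons; [|  |by []]; last first.
  apply: (measurableT_comp mF); apply: measurable_fun_pair => //.
  by apply: measurable_funD => //; exact: measurable_sqnorm.
apply: eq_integral => b _; apply: eq_integral => z _ /=.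
by rewrite sqnorm_cons addrA.
Qed.

Lemma integral_gaussian_split k m (F : k.-tuple R * R -> \bar R) :
  measurable_fun setT F -> (forall x, (0 <= F x)%E) ->
  (\int[G (k + m)]_X F (first_coords k X, sqnorm X) =
   \int[G k]_y \int[G m]_z F (y, sqnorm y + sqnorm z)%R)%E.
Proof.
elim: k F => [|k IH] F mF F0.
  rewrite integral_gaussian0.
  apply: eq_integral => z _; rewrite sqnorm0 add0r.
  by congr (F (_, _)); exact: tuple0.
rewrite (@integral_gaussian_cons _ (k + m)
  (fun X => F (first_coords k.+1 X, sqnorm X)))//; last first.
  apply: (measurableT_comp mF); apply: measurable_fun_pair.
    exact: measurable_first_coords.
  exact: measurable_sqnorm.
rewrite integral_gaussian_cons; last 2 first.
- apply: (@measurable_integral_snd _ _ _ _ R (G m)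
    (F \o (fun x => (x.1, sqnorm x.1 + sqnorm x.2)))); last first.
    by move=> z; exact: F0.
  apply: (measurableT_comp mF); apply: measurable_fun_pair => //.
  apply: measurable_funD.
    exact: (measurableT_comp (@measurable_sqnorm R k.+1)).
  exact: (measurableT_comp (@measurable_sqnorm R m)).
- by move=> x; exact: integral_ge0.
apply: eq_integral => a _.
pose Fa (x : k.-tuple R * R) := F (tuple_cons (a, x.1), a ^+ 2 + x.2).
have mFa : measurable_fun setT Fa.
  apply: (measurableT_comp mF); apply: measurable_fun_pair.
    exact: (measurableT_comp (@measurable_tuple_consl k a)).
  by measurable_tac.
under eq_integral do rewrite first_coords_cons sqnorm_cons.
rewrite (IH Fa mFa (fun=> F0 _)); apply: eq_integral => y _; apply: eq_integral => z _.
by rewrite /Fa /= sqnorm_cons addrA.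
Qed.

End gaussian_laws.

(** * Radial integration and the projection to the first coordinates *)

Section radial.
Context {R : realType}.
Local Notation mu := (@lebesgue_measure R).
Local Notation N01 := (@normal_prob R 0 1).
Local Notation G := (std_gaussian R).

(* Integrating [F * gauss_weight] against the Gaussian measure is, up to a
   factor, integrating [F] against Lebesgue measure. *)
Definition gauss_weight k (y : k.-tuple R) : \bar R :=
  (expR (sqnorm y / 2))%:E.

Lemma gauss_weight_ge0 k (y : k.-tuple R) : (0 <= gauss_weight y)%E.
Proof. by rewrite lee_fin expR_ge0. Qed.

Lemma measurable_gauss_weight k : measurable_fun setT (@gauss_weight k).
Proof.
apply/measurable_EFinP; apply: (measurableT_comp (@measurable_expR R)).
by apply: measurable_funM => //; exact: measurable_sqnorm.
Qed.

Lemma integral_weighted_cons k (F : k.+1.-tuple R -> \bar R) :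
  measurable_fun setT F -> (forall x, (0 <= F x)%E) ->
  (\int[G k.+1]_x (F x * gauss_weight x) = (normal_peak 1)%:E *
   \int[mu]_a \int[G k]_y (F (tuple_cons (a, y)) * gauss_weight y))%E.
Proof.
move=> mF F0.
pose H (x : R * k.-tuple R) : \bar R :=
  (F (tuple_cons x) * gauss_weight x.2)%E.
have mH : measurable_fun setT H.
  apply: emeasurable_funM.
    exact: (measurableT_comp mF (@measurable_tuple_cons R k)).
  exact: (measurableT_comp (@measurable_gauss_weight k)).
have H0 x : (0 <= H x)%E by rewrite mule_ge0// gauss_weight_ge0.
pose L (a : R) : \bar R := (\int[G k]_y H (a, y))%E.
have mL : measurable_fun setT L.
  exact: (@measurable_integral_snd _ _ _ _ R (G k) H mH H0).
have L0 a : (0 <= L a)%E by exact: integral_ge0.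
rewrite integral_gaussian_cons; last 2 first.
- by apply: emeasurable_funM => //; exact: measurable_gauss_weight.
- by move=> x; rewrite mule_ge0// gauss_weight_ge0.
have me : measurable_fun setT (fun a : R => (expR (a ^+ 2 / 2))%:E).
  by apply/measurable_EFinP; measurable_tac.
transitivity (\int[N01]_a ((expR (a ^+ 2 / 2))%:E * L a))%E.
  apply: eq_integral => a _.
  have mHa : measurable_fun setT (fun y => H (a, y)).
    exact: (measurableT_comp mH (pair1_measurable a)).
  rewrite -ge0_integralTZl; [|exact: mHa|by move=> y; exact: H0
    |by rewrite lee_fin expR_ge0].
  apply: eq_integral => y _.
  rewrite /gauss_weight sqnorm_cons mulrDl expRD EFinM.
  by rewrite muleCA.
rewrite ge0_integral_normalE; last 2 first.
- exact: emeasurable_funM.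
- by move=> a; rewrite mule_ge0// lee_fin expR_ge0.
congr (_ * _)%E; apply: eq_integral => a _.
by rewrite muleAC -EFinM -expRD subrr expR0 mul1e.
Qed.

(** The weight turns the Gaussian measure into a multiple of Lebesgue measure, for which scaling is
    a substitution in one coordinate after another. *)
Lemma integral_weighted_scale k c (F : k.-tuple R -> \bar R) : 0 < c ->
  measurable_fun setT F -> (forall x, (0 <= F x)%E) ->
  (\int[G k]_x (F (scale_tuple c x) * gauss_weight x) =
   (c^-1 ^+ k)%:E * \int[G k]_x (F x * gauss_weight x))%E.
Proof.
move=> c0; elim: k F => [|k IH] F mF F0.
  by rewrite !integral_gaussian0 expr0 mul1e (tuple0 (scale_tuple _ _)).
have msc : measurable_fun setT (fun x : k.+1.-tuple R => scale_tuple c x).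
  exact: (measurableT_comp (@measurable_scale_tuple R _) (pair1_measurable c)).
rewrite integral_weighted_cons; [|exact: measurableT_comp|by []].
rewrite integral_weighted_cons//.
pose H (x : R * k.-tuple R) : \bar R :=
  (F (tuple_cons x) * gauss_weight x.2)%E.
have mFc : measurable_fun setT (F \o @tuple_cons R k).
  exact: (measurableT_comp mF (@measurable_tuple_cons R k)).
have mH : measurable_fun setT H.
  apply: emeasurable_funM => //.
  exact: (measurableT_comp (@measurable_gauss_weight k)).
have H0 x : (0 <= H x)%E by rewrite mule_ge0// gauss_weight_ge0.
pose L (a : R) : \bar R := (\int[G k]_y H (a, y))%E.
have mL : measurable_fun setT L.
  exact: (@measurable_integral_snd _ _ _ _ R (G k) H mH H0).
have L0 a : (0 <= L a)%E by exact: integral_ge0.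
rewrite muleCA; congr (_ * _)%E.
transitivity (\int[mu]_a ((c^-1 ^+ k)%:E * L (c * a + 0)%R))%E.
  apply: eq_integral => a _; rewrite addr0.
  under eq_integral do rewrite scale_cons.
  apply: (IH (fun y => F (tuple_cons (c * a, y)))) => //.
  exact: (measurableT_comp mFc (pair1_measurable (c * a))).
have cV0 : 0 <= c^-1 by rewrite invr_ge0 ltW.
rewrite ge0_integralTZl; first last.
- by rewrite lee_fin exprn_ge0.
- by move=> a; exact: L0.
- by apply: (measurableT_comp mL); exact: measurable_affine.
rewrite ge0_integral_affine ?gt_eqF// gtr0_norm//.
by rewrite muleA -EFinM exprSr.
Qed.

(** This is [v_+^(m/2 - 1)], up to a constant the density of [|z|^2] for Lebesgue measure on [R^m].
    In this form it vanishes for [v <= 0] as soon as [m > 0], with no case distinction. *)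
Definition radial_weight m (v : R) : R := Num.sqrt v ^+ m / v.

Lemma radial_weight_ge0 m v : (0 < m)%N -> 0 <= radial_weight m v.
Proof.
move=> m0; rewrite /radial_weight; have [v0|v0] := leP v 0.
  by rewrite ler0_sqrtr// expr0n gtn_eqF// mul0r.
by rewrite divr_ge0 ?exprn_ge0// ltW.
Qed.

Lemma radial_weight_le0 m v : (0 < m)%N -> v <= 0 -> radial_weight m v = 0.
Proof.
by move=> m0 v0; rewrite /radial_weight ler0_sqrtr// expr0n gtn_eqF// mul0r.
Qed.

Lemma radial_weightM m u v : 0 <= u ->
  radial_weight m (u * v) = radial_weight m u * radial_weight m v.
Proof.
by move=> u0; rewrite /radial_weight sqrtrM// exprMn invfM mulrACA.
Qed.

Lemma measurable_radial_weight m : measurable_fun setT (radial_weight m).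
Proof.
apply: measurable_funM; last exact: measurable_inv.
by apply: measurable_funX; exact: measurable_sqrt.
Qed.

Lemma normal_prob_set1 (a : R) : N01 [set a] = 0%E.
Proof.
have /null_content_dominatesP := @normal_prob_dominates R 0 1.
by apply => //; exact: lebesgue_measure_set1.
Qed.

Lemma gaussian_sqnorm_eq0 m : (0 < m)%N ->
  G m [set z : m.-tuple R | sqnorm z = 0] = 0%E.
Proof.
case: m => // m _.
have -> : [set z : m.+1.-tuple R | sqnorm z = 0] =
    [set z | forall i, [set 0 : R] (tnth z i)].
  apply/seteqP; split => z /= h.
    move=> i; apply/eqP; rewrite -sqrf_eq0.
    have /eqP := h; rewrite psumr_eq0; last by move=> j _; exact: sqr_ge0.
    by move=> /allP/(_ i); rewrite mem_index_enum => /(_ erefl).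
  by rewrite /sqnorm big1// => i _; rewrite h expr0n.
rewrite (@std_gaussian_box R m.+1 (fun=> [set 0])); last by [].
by rewrite big_ord_recl normal_prob_set1 mul0e.
Qed.

End radial.

Section radial_law.
Context {R : realType}.
Local Notation mu := (@lebesgue_measure R).
Local Notation G := (std_gaussian R).

(** For [rho > 0], the uniform density on []rho / 2, rho[]. It satisfies
    [bump (u t) t = t^-1 bump u 1] for [t > 0], which separates the variables after rescaling. *)
Let bump (rho t : R) : R := if (rho / 2 < t) && (t < rho) then 2 / rho else 0.

Let bump_ge0 (rho t : R) : 0 <= rho -> 0 <= bump rho t.
Proof. by move=> rho0; rewrite /bump; case: ifP => // _; rewrite divr_ge0. Qed.

Let integral_bump (rho : R) : 0 < rho -> (\int[mu]_t (bump rho t)%:E = 1)%E.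
Proof.
move=> rho0.
transitivity (\int[mu]_t ((2 / rho)%:E * (\1_(`](rho / 2)%R, rho[%classic : set R) t)%:E))%E.
  apply: eq_integral => t _; rewrite -EFinM indicE /bump.
  have -> : (t \in `]rho / 2, rho[%classic) = (rho / 2 < t) && (t < rho).
    by apply/idP/idP; rewrite inE /= in_itv.
  by case: ifP; rewrite ?mulr1 ?mulr0.
rewrite ge0_integralTZl.
- have -> : (\int[mu]_t (\1_(`](rho / 2)%R, rho[%classic : set R) t)%:E =
      mu (`](rho / 2)%R, rho[%classic : set R))%E.
    by rewrite integral_indic// setIT.
  rewrite lebesgue_measure_itv/= lte_fin.
  rewrite ltr_pdivrMr// ltr_pMr// ltr1n -EFinB -EFinM.
  by congr (_%:E); field; rewrite gt_eqF.
- by apply/measurable_EFinP; exact: measurable_indic.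
- by move=> t; rewrite lee_fin indicE.
- by rewrite lee_fin divr_ge0// ltW.
Qed.

Let measurable_bump d (T : measurableType d) (f g : T -> R) :
  measurable_fun setT f -> measurable_fun setT g ->
  measurable_fun setT (fun x => bump (f x) (g x)).
Proof.
move=> mf mg; apply: measurable_fun_ifT.
- apply: measurable_and; apply: measurable_fun_ltr => //.
  exact: measurable_funM.
- by apply: measurable_funM => //; exact: (measurableT_comp measurable_inv).
- exact: measurable_cst.
Qed.

(* Insert [1 = \int bump(|z|^2, t) dt], exchange the integrals, rescale [z] by
   [sqrt t], and exchange back: [phi] is then integrated against
   [radial_weight] for each fixed [z]. *)
Lemma gaussian_radial m : (0 < m)%N -> exists2 K : \bar R, (0 <= K)%E &
  forall phi : R -> \bar R, measurable_fun setT phi ->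
    (forall x, (0 <= phi x)%E) ->
  (\int[G m]_z (phi (sqnorm z) * gauss_weight z) =
   K * \int[mu]_rho (phi rho * (radial_weight m rho)%:E))%E.
Proof.
move=> m0.
(* With [u = |z|^2], what remains beside the integral over [rho = u t]: the bump, the Jacobian
   [u^-1], and the factor split off from [radial_weight m (rho / u)] by multiplicativity. *)
pose kap (u : R) : R := bump u 1 * (u^-1 * radial_weight m u^-1).
have kap0 u : 0 <= u -> 0 <= kap u.
  by move=> u0; rewrite !mulr_ge0 ?bump_ge0 ?invr_ge0 ?radial_weight_ge0.
have mkap : measurable_fun setT kap.
  apply: measurable_funM; first exact: measurable_bump.
  apply: measurable_funM; first exact: measurable_inv.
  apply: (measurableT_comp (@measurable_radial_weight R m)).
  exact: measurable_inv.
exists (\int[G m]_z ((kap (sqnorm z))%:E * gauss_weight z))%E.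
  by apply: integral_ge0 => z _; rewrite mule_ge0 ?lee_fin ?kap0 ?sqnorm_ge0// expR_ge0.
move=> phi mphi phi0.
have msq := @measurable_sqnorm R m.
have mw := @measurable_gauss_weight R m.
have msq1 : measurable_fun setT (fun x : m.-tuple R * R => sqnorm x.1).
  exact: (measurableT_comp msq).
have mw1 : measurable_fun setT (fun x : m.-tuple R * R => gauss_weight x.1).
  exact: (measurableT_comp mw).
pose H (x : m.-tuple R * R) : \bar R :=
  (phi (sqnorm x.1) * gauss_weight x.1 * (bump (sqnorm x.1) x.2)%:E)%E.
have mH : measurable_fun setT H.
  apply: emeasurable_funM; last by apply/measurable_EFinP; exact: measurable_bump.
  by apply: emeasurable_funM => //; exact: (measurableT_comp mphi).
have H0 x : (0 <= H x)%E.
  by rewrite !mule_ge0 ?gauss_weight_ge0// lee_fin bump_ge0// sqnorm_ge0.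
pose H' (x : m.-tuple R * R) : \bar R :=
  (phi (sqnorm x.1 * x.2)%R * (radial_weight m x.2)%:E *
   ((bump (sqnorm x.1) 1)%:E * gauss_weight x.1))%E.
have mH' : measurable_fun setT H'.
  apply: emeasurable_funM; last first.
    by apply: emeasurable_funM => //; apply/measurable_EFinP; exact: measurable_bump.
  apply: emeasurable_funM.
    by apply: (measurableT_comp mphi); apply: measurable_funM.
  apply/measurable_EFinP.
  exact: (measurableT_comp (@measurable_radial_weight R m)).
have H'0 x : (0 <= H' x)%E.
  by rewrite !mule_ge0 ?gauss_weight_ge0// lee_fin ?bump_ge0 ?sqnorm_ge0//
    radial_weight_ge0.
(* The bump has integral 1 only for [z != 0], hence an equality almost everywhere. *)
transitivity (\int[G m]_z \int[mu]_t H (z, t))%E.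
  apply: ge0_ae_eq_integral => //.
  - by apply: emeasurable_funM => //; exact: measurableT_comp.
  - exact: (@measurable_integral_snd _ _ _ _ R mu H mH H0).
  - by move=> z _; rewrite mule_ge0// gauss_weight_ge0.
  - by move=> z _; exact: integral_ge0.
  exists [set z | sqnorm z = 0]; split.
  - by have := msq measurableT [set 0] (measurable_set1 0); rewrite setTI.
  - exact: gaussian_sqnorm_eq0.
  move=> z /=; apply: contra_notP => z0 _.
  have sz0 : 0 < sqnorm z by rewrite lt_neqAle sqnorm_ge0 eq_sym andbT; apply/eqP.
  rewrite /H /= ge0_integralTZl; first by rewrite integral_bump// mule1.
  - by apply/measurable_EFinP; exact: measurable_bump.
  - by move=> t; rewrite lee_fin bump_ge0// sqnorm_ge0.
  - by rewrite mule_ge0// gauss_weight_ge0.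
rewrite (@fubini_tonelli _ _ _ _ R (G m) mu H mH H0).
(* Rescaling [z] by [sqrt t] gives a factor [sqrt t ^+ m] and the bump gives [t^-1]; together they
   form [radial_weight m t]. For [t <= 0] both sides vanish. *)
transitivity (\int[mu]_t \int[G m]_z H' (z, t))%E.
  apply: eq_integral => t _.
  have [t0|t0] := leP t 0.
    rewrite /H /H' /= (radial_weight_le0 m0 t0) !integral0_eq//.
      by move=> z _; rewrite mule0 mul0e.
    move=> z _; rewrite /bump ifF ?mule0//; apply/negbTE/negP => /andP[+ _].
    apply/negP; rewrite -leNgt (le_trans t0)// divr_ge0//.
    exact: sqnorm_ge0.
  pose F (z : m.-tuple R) : \bar R :=
    (phi (sqnorm z) * (bump (sqnorm z) t)%:E)%E.
  have mF : measurable_fun setT F.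
    apply: emeasurable_funM; first exact: measurableT_comp.
    by apply/measurable_EFinP; exact: measurable_bump.
  have F0 z : (0 <= F z)%E by rewrite mule_ge0// lee_fin bump_ge0// sqnorm_ge0.
  have st0 : 0 < Num.sqrt t by rewrite sqrtr_gt0.
  transitivity (\int[G m]_z (F z * gauss_weight z))%E.
    by apply: eq_integral => z _; rewrite /H /F muleAC.
  have := integral_weighted_scale st0 mF F0.
  rewrite exprVn => /(congr1 (fun x => (Num.sqrt t ^+ m)%:E * x)%E).
  rewrite muleA -EFinM divff ?expf_neq0 ?gt_eqF// mul1e => <-.
  rewrite -ge0_integralTZl; first last.
  - by rewrite lee_fin exprn_ge0// sqrtr_ge0.
  - by move=> z; rewrite mule_ge0 ?gauss_weight_ge0.
  - apply: emeasurable_funM => //; apply: (measurableT_comp mF).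
    exact: (measurableT_comp (@measurable_scale_tuple R _) (pair1_measurable _)).
  apply: eq_integral => z _; rewrite /H' /F /= sqnorm_scale sqr_sqrtr ?ltW//.
  rewrite (mulrC t) -!muleA [LHS]muleCA; congr (_ * _)%E.
  rewrite !muleA; congr (_ * _)%E; rewrite -!EFinM; congr (_%:E).
  rewrite /radial_weight /bump.
  rewrite (_ : (sqnorm z * t / 2 < t) = (sqnorm z / 2 < 1)); last first.
    by rewrite mulrAC gtr_pMl.
  rewrite (_ : (t < sqnorm z * t) = (1 < sqnorm z)); last by rewrite ltr_pMl.
  case: ifP => [/andP[_ z1]|_]; last by rewrite !mulr0.
  field; rewrite !gt_eqF// (lt_trans ltr01 z1)//.
rewrite -(@fubini_tonelli _ _ _ _ R (G m) mu H' mH' H'0).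
pose I := (\int[mu]_rho (phi rho * (radial_weight m rho)%:E))%E.
have mpw u : measurable_fun setT
    (fun rho => phi rho * (radial_weight m (u * rho))%:E)%E.
  apply: emeasurable_funM => //; apply/measurable_EFinP.
  apply: (measurableT_comp (@measurable_radial_weight R m)).
  exact: mulrl_measurable.
have I0 : (0 <= I)%E.
  by apply: integral_ge0 => rho _; rewrite mule_ge0// lee_fin radial_weight_ge0.
rewrite -ge0_integralTZr; first last.
- exact: I0.
- by move=> z; rewrite mule_ge0 ?gauss_weight_ge0// lee_fin kap0// sqnorm_ge0.
- by apply: emeasurable_funM => //; apply/measurable_EFinP; exact: measurableT_comp.
apply: eq_integral => z _; rewrite /H' /=; set u := sqnorm z.
(* [bump u 1] vanishes for [u <= 1], so the substitution [rho = u t] is only made for [u > 1]. *)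
have [u1|u1] := leP u 1.
  have b0 : bump u 1 = 0.
    by rewrite /bump ifF//; apply/negbTE/negP => /andP[_]; rewrite ltNge u1.
  rewrite /kap b0 mul0r !mul0e integral0_eq// => t _.
  by rewrite mule0.
have u0 : 0 < u by rewrite (lt_trans ltr01 u1).
rewrite ge0_integralTZr; first last.
- by rewrite mule_ge0 ?gauss_weight_ge0// lee_fin bump_ge0// ltW.
- by move=> t; rewrite mule_ge0// lee_fin radial_weight_ge0.
- apply: emeasurable_funM.
    by apply: (measurableT_comp mphi); exact: mulrl_measurable.
  by apply/measurable_EFinP; exact: measurable_radial_weight.
rewrite muleC /kap EFinM -!muleA; congr (_ * _)%E.
rewrite [RHS]muleCA; congr (_ * _)%E.
transitivity (\int[mu]_t (phi (u * t + 0)%R *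
    (radial_weight m (u^-1 * (u * t + 0)))%:E))%E.
  by apply: eq_integral => t _; rewrite addr0 mulKf// gt_eqF.
have uV0 : 0 <= u^-1 by rewrite invr_ge0 ltW.
rewrite (@ge0_integral_affine _ u 0 (fun rho => phi rho *
   (radial_weight m (u^-1 * rho))%:E)%E (lt0r_neq0 u0) (mpw u^-1)); last first.
  by move=> t; rewrite mule_ge0// lee_fin radial_weight_ge0.
rewrite gtr0_norm// EFinM -muleA; congr (_ * _)%E.
rewrite -ge0_integralTZl; first last.
- by rewrite lee_fin radial_weight_ge0.
- by move=> t; rewrite mule_ge0// lee_fin radial_weight_ge0.
- by have := mpw 1; under eq_fun do rewrite mul1r.
apply: eq_integral => t _.
by rewrite radial_weightM// EFinM muleCA.
Qed.

End radial_law.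

Section gaussian_projection.
Context {R : realType}.
Local Notation mu := (@lebesgue_measure R).
Local Notation G := (std_gaussian R).

(** With [m = n - k] and [r^2 = n], this is [f_n / A_n]. *)
Definition sphere_density k m (r : R) (w : k.-tuple R) : R :=
  radial_weight m (1 - sqnorm w / r ^+ 2) * expR (sqnorm w / 2).

Lemma measurable_sphere_density k m (r : R) :
  measurable_fun setT (@sphere_density k m r).
Proof.
have ms := @measurable_sqnorm R k.
apply: measurable_funM.
  apply: (measurableT_comp (@measurable_radial_weight R m)).
  by apply: measurable_funB => //; exact: measurable_funM.
apply: (measurableT_comp (@measurable_expR R)).
exact: measurable_funM.
Qed.

Lemma sphere_density_ge0 k m (r : R) (w : k.-tuple R) : (0 < m)%N ->
  0 <= sphere_density m r w.
Proof. by move=> m0; rewrite mulr_ge0 ?radial_weight_ge0 ?expR_ge0. Qed.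

(* With [s = |y|^2 + |z|^2], a translation in [s] at fixed [y] and then the
   scaling [y = (sqrt s / r) w] at fixed [s] separate the variables. *)
Lemma gaussian_projection k m (r : R) : (0 < m)%N -> 0 < r ->
  exists2 A : \bar R, (0 <= A)%E & forall H : k.-tuple R -> \bar R,
    measurable_fun setT H -> (forall x, (0 <= H x)%E) ->
  (\int[G (k + m)]_X
     H (scale_tuple (r / Num.sqrt (sqnorm X)) (first_coords k X)) =
   A * \int[G k]_w (H w * (sphere_density m r w)%:E))%E.
Proof.
move=> m0 r0; have [K K0 radK] := gaussian_radial (R := R) m0.
(* All that depends on [s] alone: the Gaussian factor, the Jacobian of [y = (sqrt s / r) w], and the
   power of [s] taken out of [radial_weight m (s - |y|^2)]. *)
pose B (s : R) : R :=
  expR (- (s / 2)) * (Num.sqrt s / r) ^+ k * radial_weight m s.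
have mW := @measurable_radial_weight R m.
have W0 v : 0 <= @radial_weight R m v by exact: radial_weight_ge0.
have B0 s : 0 <= B s.
  apply: mulr_ge0 => //; apply: mulr_ge0; first exact: expR_ge0.
  by rewrite exprn_ge0// divr_ge0 ?sqrtr_ge0// ltW.
have mB : measurable_fun setT B.
  apply: measurable_funM => //; apply: measurable_funM; first by measurable_tac.
  apply: measurable_funX; apply: measurable_funM => //.
  exact: measurable_sqrt.
have EB0 : (0 <= \int[mu]_s (B s)%:E)%E.
  by apply: integral_ge0 => s _; rewrite lee_fin.
exists (K * \int[mu]_s (B s)%:E)%E; first by rewrite mule_ge0.
move=> H mH H0.
have msq := @measurable_sqnorm R k.
have mw := @measurable_gauss_weight R k.
have w0 := @gauss_weight_ge0 R k.
pose F (x : k.-tuple R * R) : \bar R := H (scale_tuple (r / Num.sqrt x.2) x.1).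
have mF : measurable_fun setT F.
  pose c (x : k.-tuple R * R) := (r / Num.sqrt x.2, x.1).
  have mc : measurable_fun setT c.
    apply: measurable_fun_pair => //; apply: measurable_funM => //.
    apply: (measurableT_comp measurable_inv).
    exact: (measurableT_comp measurable_sqrt).
  exact: (measurableT_comp mH (measurableT_comp (@measurable_scale_tuple R k) mc)).
have F0 x : (0 <= F x)%E by exact: H0.
rewrite (@integral_gaussian_split R k m F mF F0).
(* For [rho = s - |y|^2], the factor [e^(- rho / 2)] splits into [e^(- s / 2)] and [gauss_weight y],
   the weight under which [y] can be rescaled. *)
pose Q (x : k.-tuple R * R) : \bar R := (F x * ((expR (- (x.2 / 2)))%:E *
  (radial_weight m (x.2 - sqnorm x.1))%:E * gauss_weight x.1))%E.
have mQ : measurable_fun setT Q.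
  apply: emeasurable_funM => //; apply: emeasurable_funM; last first.
    exact: (measurableT_comp mw).
  apply: emeasurable_funM; first by measurable_tac.
  apply/measurable_EFinP; apply: (measurableT_comp mW).
  by apply: measurable_funB => //; exact: (measurableT_comp msq).
have Q0 x : (0 <= Q x)%E.
  apply: mule_ge0; first exact: F0.
  by rewrite mule_ge0// -EFinM lee_fin mulr_ge0// expR_ge0.
have mQs : measurable_fun setT (fun y => \int[mu]_s Q (y, s))%E.
  exact: (@measurable_integral_snd _ _ _ _ R mu Q mQ Q0).
transitivity (\int[G k]_y (K * \int[mu]_s Q (y, s)))%E.
  apply: eq_integral => y _.
  (* The exponential cancels [gauss_weight z], so that the radial formula applies to a plain
     Gaussian integral. *)
  pose phi (rho : R) : \bar R :=
    (F (y, sqnorm y + rho)%R * (expR (- (rho / 2)))%:E)%E.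
  have mphi : measurable_fun setT phi.
    apply: emeasurable_funM; last by measurable_tac.
    have mFy := measurableT_comp mF (pair1_measurable y).
    by apply: (measurableT_comp mFy); apply: measurable_funD.
  have phi0 rho : (0 <= phi rho)%E by rewrite mule_ge0// lee_fin expR_ge0.
  transitivity (\int[G m]_z (phi (sqnorm z) * gauss_weight z))%E.
    apply: eq_integral => z _; rewrite /phi -muleA -EFinM -expRD addNr expR0.
    by rewrite mule1.
  rewrite radK//; congr (_ * _)%E.
  pose psi rho : \bar R := (phi rho * (radial_weight m rho)%:E)%E.
  have mpsi : measurable_fun setT psi.
    by apply: emeasurable_funM => //; exact/measurable_EFinP.
  have psi0 rho : (0 <= psi rho)%E by rewrite mule_ge0// lee_fin.
  have := @ge0_integral_affine R 1 (- sqnorm y) psi (oner_neq0 _) mpsi psi0.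
  rewrite normr1 invr1 mul1e => <-; apply: eq_integral => s _.
  rewrite /psi /phi mul1r addrC subrK -muleA; congr (_ * _)%E.
  rewrite -!EFinM mulrAC -expRD; congr (expR _ * _)%:E.
  by rewrite /=; field.
rewrite ge0_integralTZl; first last.
- exact: K0.
- by move=> y; exact: integral_ge0.
- exact: mQs.
rewrite -muleA; congr (_ * _)%E.
rewrite (@fubini_tonelli _ _ _ _ R (G k) mu Q mQ Q0).
set I := (\int[G k]_w _)%E.
have I0 : (0 <= I)%E.
  by apply: integral_ge0 => w _; rewrite mule_ge0// lee_fin sphere_density_ge0.
rewrite -ge0_integralTZr; first last.
- exact: I0.
- by move=> s; rewrite lee_fin.
- exact/measurable_EFinP.
apply: eq_integral => s _.
have [s0|s0] := leP s 0.
  rewrite /B (radial_weight_le0 m0 s0) mulr0 mul0e integral0_eq// => y _.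
  rewrite /Q /= radial_weight_le0 ?mule0 ?mul0e ?mule0//.
  by rewrite subr_le0 (le_trans s0)// sqnorm_ge0.
have ss0 : 0 < Num.sqrt s by rewrite sqrtr_gt0.
have rs0 : 0 < r / Num.sqrt s by rewrite divr_gt0.
have rs2 : (r / Num.sqrt s) ^+ 2 = r ^+ 2 / s.
  by rewrite expr_div_n sqr_sqrtr// ltW.
pose F' (w : k.-tuple R) : \bar R :=
  (H w * (radial_weight m (s - s / r ^+ 2 * sqnorm w))%:E)%E.
have mF' : measurable_fun setT F'.
  apply: emeasurable_funM => //; apply/measurable_EFinP.
  apply: (measurableT_comp mW); apply: measurable_funB => //.
  exact: measurable_funM.
have F'0 w : (0 <= F' w)%E by rewrite mule_ge0// lee_fin.
transitivity ((expR (- (s / 2)))%:E * \int[G k]_y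
    (F' (scale_tuple (r / Num.sqrt s) y) * gauss_weight y))%E.
  rewrite -ge0_integralTZl; first last.
  - by rewrite lee_fin expR_ge0.
  - by move=> y; rewrite mule_ge0.
  - apply: emeasurable_funM => //; apply: (measurableT_comp mF').
    exact: (measurableT_comp (@measurable_scale_tuple R _) (pair1_measurable _)).
  apply: eq_integral => y _; rewrite /Q /F' /F /= sqnorm_scale rs2.
  have -> : s / r ^+ 2 * (r ^+ 2 / s * sqnorm y) = sqnorm y.
    by field; rewrite !gt_eqF.
  by rewrite -!muleA [RHS]muleCA.
rewrite (integral_weighted_scale rs0 mF' F'0) muleA -EFinM.
have -> : (B s)%:E = ((expR (- (s / 2)) * (r / Num.sqrt s)^-1 ^+ k)%:E *
    (radial_weight m s)%:E)%E by rewrite -EFinM invf_div.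
rewrite -muleA; congr (_ * _)%E.
rewrite -ge0_integralTZl; first last.
- by rewrite lee_fin.
- by move=> w; rewrite mule_ge0// lee_fin sphere_density_ge0.
- apply: emeasurable_funM => //; apply/measurable_EFinP.
  exact: measurable_sphere_density.
apply: eq_integral => w _; rewrite /F' /sphere_density.
have -> : s - s / r ^+ 2 * sqnorm w = s * (1 - sqnorm w / r ^+ 2).
  by field; rewrite gt_eqF.
by rewrite radial_weightM ?ltW// EFinM -!muleA [RHS]muleCA.
Qed.

End gaussian_projection.

(** * Uniqueness of the uniform measure on a sphere *)

Section orthants.
Context {R : realType} (n : nat).
Local Notation T := (n.-tuple R).

(** A bound [+oo] leaves its coordinate free. Orthants thus include the whole space and the
    coordinate half-spaces, which generate the sigma-algebra. *)
Definition orthant (b : 'I_n -> \bar R) : set T :=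
  [set z | forall i, ((tnth z i)%:E < b i)%E].

Definition orthants : set (set T) := range orthant.

Lemma orthants_setI_closed : setI_closed orthants.
Proof.
move=> _ _ [b _ <-] [c _ <-]; exists (fun i => Order.min (b i) (c i)) => //.
apply/seteqP; split => z /=.
  by move=> h; split => i; have := h i; rewrite lt_min => /andP[].
by move=> [h1 h2] i; rewrite lt_min h1 h2.
Qed.

Lemma measurable_orthant b : measurable (orthant b).
Proof.
rewrite (_ : orthant b =
    \bigcap_(i in [set: 'I_n]) [set z | ((tnth z i)%:E < b i)%E]); last first.
  by apply/seteqP; split => z /= h i; [move=> _|]; exact: h.
apply: fin_bigcap_measurable => // i _.
rewrite -[X in measurable X]setTI.
apply: emeasurable_fun_infty_o => //.
by apply/measurable_EFinP; exact: measurable_tnth.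
Qed.

Lemma measurable_orthantsE : @measurable _ T = <<s orthants >>.
Proof.
apply/seteqP; split => A; last first.
  apply: smallest_sub; first exact: sigma_algebra_measurable.
  by move=> _ [b _ <-]; exact: measurable_orthant.
pose f (x : g_sigma_algebraType orthants) : T := x.
have mf : measurable_fun setT f.
  apply/measurable_fun_tnthP => i.
  apply: (measurability _ (RGenInftyO.measurableE R)) => //.
  move=> _ [_ [a ->] <-]; rewrite setTI; apply: sub_sigma_algebra.
  exists (fun j => if j == i then a%:E else +oo%E) => //.
  apply/seteqP; split => z /=.
    by move/(_ i); rewrite eqxx lte_fin in_itv.
  by rewrite in_itv/= => zi j; case: eqVneq => [->|_]; rewrite ?lte_fin ?ltry.
by move=> mA; have := mf measurableT A mA; rewrite setTI.
Qed.

End orthants.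

Section caps.
Context {R : realType} (n : nat) (r : R).
Local Notation T := (n.-tuple R).
Hypothesis r0 : 0 < r.

Definition cap (x : T) (c : R) : set T := [set z | c < dot x z].

Lemma dotC (x y : T) : dot x y = dot y x.
Proof. by apply: eq_bigr => i _; rewrite mulrC. Qed.

Lemma sphereP (x : T) : sphere n r x <-> sqnorm x = r ^+ 2.
Proof.
rewrite /sphere /euclidean_norm /= -/(sqnorm x); split => [<-|->].
  by rewrite sqr_sqrtr ?sqnorm_ge0.
by rewrite sqrtr_sqr gtr0_norm.
Qed.

Lemma measurable_sphere : measurable (sphere n r : set T).
Proof.
rewrite (_ : sphere n r = @sqnorm R n @^-1` [set r ^+ 2]); last first.
  by apply/seteqP; split => x /sphereP.
by have := @measurable_sqnorm R n measurableT [set r ^+ 2] (measurable_set1 _); rewrite setTI.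
Qed.

Lemma measurable_dot2 : measurable_fun setT (fun x : T * T => dot x.1 x.2).
Proof.
apply: measurable_sum => i; apply: measurable_funM.
  exact: (measurableT_comp (measurable_tnth i)).
exact: (measurableT_comp (measurable_tnth i)).
Qed.

Lemma measurable_cap x c : measurable (cap x c).
Proof.
rewrite -[X in measurable X]setTI.
by apply: (measurable_fun_ltr (measurable_cst c) (measurable_dot x)
  measurableT (Y := [set true])).
Qed.

(** On the sphere [|z - x|^2 = 2 r^2 - 2 <x, z> < d^2], which bounds each coordinate of [z - x]. *)
Lemma cap_near (x z : T) (d : R) i : sphere n r x -> sphere n r z ->
  r ^+ 2 - d ^+ 2 / 2 < dot x z -> 0 < d -> tnth z i < tnth x i + d.
Proof.
move=> /sphereP xr /sphereP zr xz d0; rewrite -ltrBlDl.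
have [//|dle] := ltP (tnth z i - tnth x i) d.
suff : d ^+ 2 < d ^+ 2 by rewrite ltxx.
apply: (@le_lt_trans _ _ (\sum_(j < n) (tnth z j - tnth x j) ^+ 2)).
  rewrite (bigD1 i)//= ler_wpDr//.
    by apply: sumr_ge0 => j _; exact: sqr_ge0.
  by rewrite lerXn2r ?nnegrE ?(ltW d0)// (le_trans (ltW d0)).
have -> : \sum_(j < n) (tnth z j - tnth x j) ^+ 2 =
    sqnorm z + sqnorm x - 2 * dot x z.
  rewrite /sqnorm /dot mulr_sumr -big_split -sumrB /=.
  by apply: eq_bigr => j _; ring.
by rewrite xr zr; lra.
Qed.

Local Notation S := (sphere n r : set T).

Lemma sphere_measure_setI (m : probability T R) (A : set T) :
  m S = 1%E -> measurable A -> m (A `&` S) = m A.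
Proof.
move=> mS mA; have mSs : measurable S by exact: measurable_sphere.
have mCS : measurable (~` S) by exact: measurableC.
have -> : m A = (m (A `&` S) + m (A `&` ~` S))%E.
  rewrite -measureU//; [|exact: measurableI|exact: measurableI|].
  - by rewrite -setIUr setUCr setIT.
  - by rewrite setIACA setICr setI0.
have -> : m (A `&` ~` S) = 0%E.
  have mCS0 : m (~` S) = 0%E by rewrite probability_setC// mS subee.
  by apply: subset_measure0 mCS0 => //; exact: measurableI.
by rewrite adde0.
Qed.

(** Its section at a fixed [x] is part of a cap about [x], its section at a fixed [z] part of a cap
    about [z]. The two orders of integration thus relate [P] to [Q]. *)
Definition near_pairs (A B : set T) c : set (T * T) :=
  [set x | [/\ S x.1, S x.2, A x.1, B x.2 & c < dot x.1 x.2]].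

Lemma measurable_near_pairs A B c : measurable A -> measurable B ->
  measurable (near_pairs A B c).
Proof.
move=> mA mB; have mS : measurable S by exact: measurable_sphere.
have -> : near_pairs A B c = ((S `&` A) `*` (S `&` B)) `&`
    [set x | c < dot x.1 x.2].
  apply/seteqP; split => [x [? ? ? ? ?]|x [[[? ?] [? ?]] ?]]; split => //.
apply: measurableI; first by apply: measurableX; exact: measurableI.
rewrite -[X in measurable X]setTI.
by apply: (measurable_fun_ltr (measurable_cst c) measurable_dot2
  measurableT (Y := [set true])).
Qed.

Lemma integral_near_pairs (P Q : probability T R) (h : R -> \bar R) A c :
  P S = 1%E -> Q S = 1%E -> (forall x c, S x -> Q (cap x c) = h c) ->
  measurable A ->
  (\int[P]_x \int[Q]_z (\1_(near_pairs A setT c) (x, z))%:E = h c * P A)%E.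
(* The inner integral is the cap mass [h c] when [x] lies in [A] and on the sphere, and 0
   otherwise. *)
Proof.
move=> PS QS Qh mA; have mS : measurable S by exact: measurable_sphere.
transitivity (\int[P]_x (h c * (\1_(A `&` S) x)%:E))%E.
  apply: eq_integral => x _.
  have [[Ax Sx]|nASx] := pselect ((A `&` S) x).
    rewrite [in RHS]indicE mem_set// mule1 -(Qh x c Sx).
    rewrite -(sphere_measure_setI QS (measurable_cap x c)).
    rewrite -[in RHS](setIT (_ `&` _)) -integral_indic//; last first.
      by apply: measurableI => //; exact: measurable_cap.
    apply: eq_integral => z _; rewrite !indicE; congr ((nat_of_bool _)%:R)%:E.
    by apply/idP/idP; rewrite !inE /near_pairs /= => -[]// *; split.
  rewrite [in RHS]indicE memNset// mule0 integral0_eq// => z _.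
  by rewrite indicE memNset//= => -[? ? ? ? ?]; apply: nASx.
have h0 : (0 <= h c)%E.
  have [x Sx] : S !=set0.
    apply/set0P/eqP => S0; move: PS; rewrite S0 measure0 => /eqP.
    by rewrite eqe eq_sym oner_eq0.
  by rewrite -(Qh x c Sx).
rewrite ge0_integralTZl//; last first.
  by apply/measurable_EFinP/measurable_indic; exact: measurableI.
congr (_ * _)%E; rewrite -(sphere_measure_setI PS mA).
by rewrite integral_indic ?setIT//; exact: measurableI.
Qed.

(** Tonelli and the symmetry of the scalar product: the caps are now about [z] and are measured by
    [P]. *)
Lemma integral_near_pairsC (P Q : probability T R) (h : R -> \bar R) B c :
  P S = 1%E -> Q S = 1%E -> (forall x c, S x -> P (cap x c) = h c) ->
  measurable B ->
  (\int[P]_x \int[Q]_z (\1_(near_pairs setT B c) (x, z))%:E = h c * Q B)%E.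
Proof.
move=> PS QS Ph mB.
pose f (x : T * T) : \bar R := (\1_(near_pairs setT B c) x)%:E.
have mf : measurable_fun setT f.
  by apply/measurable_EFinP/measurable_indic; exact: measurable_near_pairs.
have f0 x : (0 <= f x)%E by rewrite lee_fin.
rewrite (@fubini_tonelli _ _ _ _ R P Q f mf f0).
rewrite -(integral_near_pairs c QS PS Ph mB).
apply: eq_integral => z _; apply: eq_integral => x _.
rewrite /f !indicE; congr ((nat_of_bool _)%:R)%:E.
by apply/idP/idP; rewrite !inE /near_pairs /= dotC => -[]// *; split.
Qed.

Lemma cap_mass_eq (P Q : probability T R) (hP hQ : R -> \bar R) :
  P S = 1%E -> Q S = 1%E -> (forall x c, S x -> P (cap x c) = hP c) ->
  (forall x c, S x -> Q (cap x c) = hQ c) -> hP =1 hQ.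
Proof.
move=> PS QS Ph Qh c.
have := integral_near_pairs c PS QS Qh measurableT.
by rewrite (integral_near_pairsC c PS QS Ph measurableT) !probability_setT !mule1.
Qed.

(* If [x] lies in the orthant shrunk by [d], then the points of the sphere close
   to [x] lie in the orthant itself. *)
Lemma orthant_mass_le (P Q : probability T R) (h : R -> \bar R) b :
  P S = 1%E -> Q S = 1%E ->
  (forall x c, S x -> P (cap x c) = h c) ->
  (forall x c, S x -> Q (cap x c) = h c) ->
  (forall c, c < r ^+ 2 -> (0 < h c)%E) -> (P (orthant b) <= Q (orthant b))%E.
Proof.
move=> PS QS Ph Qh h_gt0.
(* The orthant is shrunk by [1 / (j + 1)]; as its inequalities are strict, it is the increasing
   union of the shrunk ones. *)
pose U (j : nat) : set T := orthant (fun i => b i - (j.+1%:R^-1)%:E)%E.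
have mU j : measurable (U j) by exact: measurable_orthant.
have UE j z : U j z <-> forall i, ((tnth z i + j.+1%:R^-1)%:E < b i)%E.
  by split => h' i; have := h' i; rewrite EFinD lteBrDr.
have PQ j : (P (U j) <= Q (orthant b))%E.
  pose d : R := j.+1%:R^-1; have d0 : 0 < d by rewrite invr_gt0.
  pose c := r ^+ 2 - d ^+ 2 / 2.
  have hc0 : (0 < h c)%E.
    by apply: h_gt0; rewrite ltrBlDr ltrDl divr_gt0// exprn_gt0.
  have hc1 : (h c <= 1)%E.
    have [x Sx] : S !=set0.
      apply/set0P/eqP => S0; move: PS; rewrite S0 measure0 => /eqP.
      by rewrite eqe eq_sym oner_eq0.
    by rewrite -(Ph x c Sx); apply: probability_le1; exact: measurable_cap.
  have hfin : h c \is a fin_num.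
    by rewrite ge0_fin_numE ?(ltW hc0)// (le_lt_trans hc1)// ltry.
  (* Cancelling [h c] requires it to be positive and finite. The two sides are the integrals of the
     indicators of two sets of near pairs, the first contained in the second. *)
  suff : (h c * P (U j) <= h c * Q (orthant b))%E.
    by rewrite lee_pmul2l.
  rewrite -(integral_near_pairs c PS QS Qh (mU j)).
  rewrite -(integral_near_pairsC c PS QS Ph (measurable_orthant b)).
  have mi A B : measurable A -> measurable B -> measurable_fun setT
      (fun x => (\1_(near_pairs A B c) x)%:E : \bar R).
    move=> mA mB.
    by apply/measurable_EFinP/measurable_indic; exact: measurable_near_pairs.
  have m1 := mi _ _ (mU j) measurableT.
  have m2 := mi _ _ measurableT (measurable_orthant b).
  apply: ge0_le_integral => //.
  - by move=> x _; exact: integral_ge0.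
  - exact: (@measurable_integral_snd _ _ _ _ R Q _ m1).
  - exact: (@measurable_integral_snd _ _ _ _ R Q _ m2).
  move=> x _; apply: ge0_le_integral => //.
  - exact: (measurableT_comp m1 (pair1_measurable x)).
  - exact: (measurableT_comp m2 (pair1_measurable x)).
  move=> z _; rewrite lee_fin !indicE ler_nat.
  have [|//] := boolP ((x, z) \in near_pairs (U j) setT c).
  rewrite inE => -[/= Sx Sz Ux _ xz]; rewrite mem_set//; split => //= i.
  apply: le_lt_trans ((UE j x).1 Ux i); rewrite lee_fin.
  exact/ltW/(cap_near i Sx Sz xz d0).
have Ucup : \bigcup_j U j = orthant b.
  apply/seteqP; split => z.
    move=> [j _ /UE Uz] i; apply: lt_trans (Uz i).
    by rewrite lte_fin ltrDl invr_gt0.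
  move=> zb.
  have /choice[f fP] i : exists j : nat, ((tnth z i + j.+1%:R^-1)%:E < b i)%E.
    have := zb i; case: (b i) => [a| |] //; last by exists 0%N; rewrite ltry.
    rewrite lte_fin => za; have az0 : 0 < a - tnth z i by rewrite subr_gt0.
    exists (Num.truncn (a - tnth z i)^-1); rewrite lte_fin -ltrBrDl.
    rewrite invf_plt ?posrE//.
    by rewrite truncnS_gt.
  (* There are finitely many coordinates, so one index serves them all. *)
  exists (\max_i f i)%N => //; apply/UE => i.
  apply: le_lt_trans (fP i); rewrite lee_fin lerD2l lef_pV2 ?posrE//.
  by rewrite ler_nat ltnS leq_bigmax.
have ndU : nondecreasing_seq U.
  move=> i j ij; apply/subsetPset => z /UE h' ; apply/UE => l.
  apply: le_lt_trans (h' l); rewrite lee_fin lerD2l lef_pV2 ?posrE//.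
  by rewrite ler_nat ltnS.
rewrite -Ucup.
have := nondecreasing_cvg_mu mU (bigcupT_measurable _ mU) ndU.
move=> /(_ _ P) cvgP.
rewrite -(cvg_lim _ cvgP)//; apply: lime_le.
  by apply/cvg_ex; eexists; exact: cvgP.
by apply: nearW => j; rewrite Ucup; exact: PQ.
Qed.

Lemma sphere_measure_unique (P Q : probability T R) (hP hQ : R -> \bar R) :
  P S = 1%E -> Q S = 1%E ->
  (forall x c, S x -> P (cap x c) = hP c) ->
  (forall x c, S x -> Q (cap x c) = hQ c) ->
  (forall c, c < r ^+ 2 -> (0 < hQ c)%E) ->
  forall A, measurable A -> P A = Q A.
Proof.
move=> PS QS Ph Qh h_gt0.
have {}Ph x c : S x -> P (cap x c) = hQ c.
  by move=> Sx; rewrite (Ph x c Sx); exact: cap_mass_eq Ph Qh c.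
move=> A mA; apply: (@measure_unique _ R T (@orthants R n) (fun=> setT)) => //.
- exact: measurable_orthantsE.
- exact: orthants_setI_closed.
- move=> _; exists (fun=> +oo%E) => //.
  by apply/seteqP; split => z //= _ i; rewrite ltry.
- by apply/seteqP; split => // z _; exists 0%N.
- move=> _ [b _ <-]; apply/eqP; rewrite eq_le.
  by rewrite (orthant_mass_le b PS QS Ph Qh)// (orthant_mass_le b QS PS Qh Ph).
- by move=> _; apply: le_lt_trans (probability_le1 P measurableT) (ltry 1).
Qed.

End caps.

(** * Rotations act transitively on the sphere *)

Section rotations.
Context {R : realType}.

Definition householder n (v : 'cV[R]_n) : 'M[R]_n :=
  1%:M - (2 / (v^T *m v) 0 0) *: (v *m v^T).

Lemma householder_orthogonal n (v : 'cV[R]_n) : (v^T *m v) 0 0 != 0 ->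
  (householder v)^T *m householder v = 1%:M.
Proof.
set q := (v^T *m v) 0 0 => q0; rewrite /householder -/q.
have PP : (v *m v^T) *m (v *m v^T) = q *: (v *m v^T).
  rewrite mulmxA -(mulmxA v) (mx11_scalar (v^T *m v)) -/q.
  by rewrite mul_mx_scalar -scalemxAl.
have -> : (1%:M - (2 / q) *: (v *m v^T))^T = 1%:M - (2 / q) *: (v *m v^T).
  by rewrite linearB/= linearZ/= trmx1 trmx_mul trmxK.
set P := v *m v^T in PP *; set a := 2 / q.
have aaq : a *: (a *: (q *: P)) = a *: P + a *: P.
  by rewrite !scalerA -scalerDl; congr (_ *: _); rewrite /a; field.
rewrite mulmxBl !mulmxBr mul1mx mulmx1 mul1mx -scalemxAl -scalemxAr PP aaq.
by rewrite opprB addrK subrK.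
Qed.

(** The reflection along [e - u] exchanges the unit vectors [e] and [u = x / r]; the identity serves
    if they coincide. The dimension is at least 2 so that the determinant can be corrected without
    moving [e]. *)
Lemma exists_rotation n r (x : n.+2.-tuple R) : 0 < r -> sqnorm x = r ^+ 2 ->
  exists2 V : 'M[R]_n.+2, is_rotation V &
    forall i, V i ord0 * r = tnth x i.
Proof.
move=> r0 xr.
pose u : 'cV[R]_n.+2 := \col_i (tnth x i / r).
pose e : 'cV[R]_n.+2 := delta_mx ord0 0.
have uu : (u^T *m u) 0 0 = 1.
  rewrite mxE; under eq_bigr do rewrite !mxE -expr2 expr_div_n.
  by rewrite -mulr_suml -/(sqnorm x) xr divff// expf_neq0// gt_eqF.
have [W WW We] : exists2 W : 'M[R]_n.+2, W^T *m W = 1%:M & W *m e = u.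
  have [ue|ue] := eqVneq e u.
    by exists 1%:M; rewrite ?trmx1 mul1mx.
  pose v := e - u; pose q := (v^T *m v) 0 0.
  have ve : (v^T *m e) 0 0 = 1 - u ord0 0.
    rewrite mxE (bigD1 ord0)//= big1 ?addr0; last first.
      by move=> i i0; rewrite !mxE (negbTE i0) mulr0.
    by rewrite !mxE !eqxx mulr1.
  (* [|v|^2 = 2 <v, e>], so the reflection subtracts from [e] exactly once [v], which leaves [u]. *)
  have qE : q = 2 * (1 - u ord0 0).
    have -> : q = (v^T *m e) 0 0 - (v^T *m u) 0 0.
      by rewrite /q {2}/v mulmxBr !mxE.
    have -> : (v^T *m u) 0 0 = u ord0 0 - 1.
      rewrite /v linearB/= mulmxBl mxE [X in _ + X]mxE uu; congr (_ - _).
      rewrite mxE (bigD1 ord0)//= big1 ?addr0; last first.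
        by move=> i i0; rewrite !mxE (negbTE i0) mul0r.
      by rewrite !mxE !eqxx mul1r.
    by rewrite ve; ring.
  have q0 : q != 0.
    apply: contra ue => /eqP q0; rewrite -subr_eq0 -/v.
    have : \sum_i (v i 0) ^+ 2 = 0.
      by rewrite -[RHS]q0 /q [RHS]mxE; apply: eq_bigr => i _; rewrite [v^T _ _]mxE expr2.
    move/eqP; rewrite psumr_eq0; last by move=> i _; exact: sqr_ge0.
    move=> /allP vi; apply/eqP/matrixP => i j; rewrite ord1 [RHS]mxE.
    by have := vi i; rewrite mem_index_enum sqrf_eq0 => /(_ erefl)/eqP.
  exists (householder v); first exact: householder_orthogonal.
  rewrite /householder -/q mulmxBl mul1mx -scalemxAl -mulmxA.
  rewrite (mx11_scalar (v^T *m e)) ve mul_mx_scalar scalerA qE.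
  rewrite (_ : _ * _ = 1) ?scale1r; first by rewrite /v subKr.
  move: q0; rewrite qE mulf_eq0 pnatr_eq0/= => q0.
  by field.
have colE (V : 'M[R]_n.+2) : V *m e = u -> forall i, V i ord0 * r = tnth x i.
  move=> Ve i; have := congr1 (fun A : 'cV_n.+2 => A i 0) Ve.
  rewrite !mxE (bigD1 ord0)//= big1 ?addr0; last first.
    by move=> j j0; rewrite !mxE (negbTE j0) mulr0.
  by rewrite !mxE !eqxx mulr1 => ->; rewrite divfK// gt_eqF.
have : \det W ^+ 2 = 1.
  by rewrite expr2 -{1}det_tr -det_mulmx WW det1.
move/eqP; rewrite sqrf_eq1 => /orP[/eqP dW|/eqP dW].
  by exists W => //; exact: colE.
(* Correct the determinant by a reflection fixing the first basis vector. *)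
pose d : 'rV[R]_n.+2 := \row_j (if j == lift ord0 ord0 then -1 else 1).
pose D := diag_mx d.
have DD : D^T *m D = 1%:M.
  rewrite tr_diag_mx mulmx_diag; apply/matrixP => i j; rewrite !mxE.
  by case: ifP => _; rewrite ?mulrNN mulr1.
have De : D *m e = e.
  apply/matrixP => i j; rewrite ord1 mul_diag_mx !mxE.
  by case: ifP => [/eqP ->|_]; rewrite ?mul1r//= mulr0.
have dD : \det D = -1.
  rewrite det_diag (bigD1 (lift ord0 ord0))//= big1 ?mulr1.
    by rewrite mxE eqxx.
  by move=> i i0; rewrite mxE (negbTE i0).
exists (W *m D); last by apply: colE; rewrite -mulmxA De.
split; last by rewrite det_mulmx dW dD mulrNN mulr1.
by rewrite trmx_mul -mulmxA (mulmxA W^T) WW mul1mx.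
Qed.

(** For a rotation [V] that sends the first basis vector [e] to [x / r], one has
    [<x, V z> = r <V e, V z> = r z_0]. *)
Lemma uniform_cap n r (sigma : probability (n.+2.-tuple R) R) x c : 0 < r ->
  is_uniform_on_sphere r sigma -> sphere n.+2 r x ->
  sigma (cap x c) = sigma [set z | c < r * tnth z ord0].
Proof.
move=> r0 [_ inv] /(sphereP r0) xr.
have [V [VV dV] Vx] := exists_rotation r0 xr.
rewrite -(inv V)//; last exact: measurable_cap.
congr (sigma _); apply/seteqP.
suff E z : dot x (mx_act V z) = r * tnth z ord0.
  by split => z /=; rewrite /cap /= E.
rewrite /dot.
under eq_bigr => i _ do rewrite tnth_mktuple -Vx mulr_sumr.
rewrite exchange_big/= (bigD1 ord0)//= [X in _ + X]big1 ?addr0.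
  under eq_bigr do rewrite mulrA.
  rewrite -mulr_suml; congr (_ * _).
  have := congr1 (fun A : 'M[R]_n.+2 => A ord0 ord0) VV; rewrite !mxE eqxx.
  move=> /(congr1 (fun t => r * t)); rewrite mulr1 mulr_sumr => E1; rewrite -[RHS]E1.
  by apply: eq_bigr => i _; rewrite mxE; ring.
move=> j j0; under eq_bigr do rewrite mulrA.
rewrite -mulr_suml; apply/eqP; rewrite mulf_eq0; apply/orP; left; apply/eqP.
have := congr1 (fun A : 'M[R]_n.+2 => A ord0 j) VV.
rewrite !mxE eq_sym (negbTE j0).
move=> /(congr1 (fun t => r * t)); rewrite mulr0 mulr_sumr => E0; rewrite -[RHS]E0.
by apply: eq_bigr => i _; rewrite mxE; ring.
Qed.

End rotations.

(** * The law of the direction of a Gaussian vector *)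

Section gaussian_direction.
Context {R : realType}.
Local Notation mu := (@lebesgue_measure R).
Local Notation N01 := (@normal_prob R 0 1).
Local Notation G := (std_gaussian R).

Lemma normal_prob_itv_gt0 (a b : R) : a < b -> (0 < N01 `]a, b[)%E.
Proof.
move=> ab; pose M := `|a| + `|b|.
pose m : R := normal_peak 1 * expR (- (M ^+ 2 / 2)).
have m0 : 0 < m by rewrite mulr_gt0 ?expR_gt0// normal_peak_gt0 ?oner_eq0.
have mab : (m%:E * (b - a)%:E)%E = (\int[mu]_(x in `]a, b[) m%:E)%E.
  rewrite integral_cst//; congr (_ * _)%E.
  by have := lebesgue_measure_itv `]a, b[; rewrite /= lte_fin ab -EFinB => <-.
apply: (@lt_le_trans _ _ (m%:E * (b - a)%:E)%E).
  by rewrite -EFinM lte_fin mulr_gt0// subr_gt0.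
rewrite mab /normal_prob; apply: ge0_le_integral => //.
- by move=> x _; rewrite lee_fin ltW.
- by apply/measurable_EFinP/measurable_funTS; exact: measurable_normal_pdf.
move=> x /=; rewrite in_itv/= => /andP[ax xb].
rewrite lee_fin normal_pdf01E ler_pM2l ?normal_peak_gt0 ?oner_eq0//.
have xM : `|x| <= M.
  rewrite /M ler_norml; have := ler_norm b; have := ler_norm (- a).
  by rewrite normrN; have := normr_ge0 a; have := normr_ge0 b; lra.
rewrite ler_expR lerN2 ler_wpM2r// -real_normK ?num_real//.
by rewrite lerXn2r ?nnegrE// (le_trans _ xM).
Qed.

Definition to_sphere n (r : R) (X : n.-tuple R) : n.-tuple R :=
  scale_tuple (r / Num.sqrt (sqnorm X)) X.

Lemma measurable_to_sphere n r : measurable_fun setT (@to_sphere n r).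
Proof.
pose c (X : n.-tuple R) := (r / Num.sqrt (sqnorm X), X).
have mc : measurable_fun setT c.
  apply: measurable_fun_pair => //; apply: measurable_funM => //.
  apply: (measurableT_comp measurable_inv).
  apply: (measurableT_comp measurable_sqrt).
  exact: measurable_sqnorm.
exact: (measurableT_comp (@measurable_scale_tuple R n) mc).
Qed.

HB.instance Definition _ n r :=
  isMeasurableFun.Build _ _ _ _ (@to_sphere n r) (@measurable_to_sphere n r).

Lemma sqnorm_to_sphere n r (X : n.-tuple R) : sqnorm X != 0 ->
  sqnorm (to_sphere r X) = r ^+ 2.
Proof.
move=> X0; rewrite sqnorm_scale expr_div_n sqr_sqrtr ?sqnorm_ge0//.
by rewrite divfK.
Qed.

Lemma dot_scale n c (x y : n.-tuple R) :
  dot x (scale_tuple c y) = c * dot x y.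
Proof.
by rewrite /dot mulr_sumr; apply: eq_bigr => i _; rewrite tnth_mktuple mulrCA.
Qed.

Section sphere_law.
Variables (n : nat) (r : R) (P : probability (n.-tuple R) R).
Hypothesis r0 : 0 < r.

Definition sphere_law : probability (n.-tuple R) R :=
  distribution P (@to_sphere n r).

Lemma measurable_to_sphere_preimage A : measurable A ->
  measurable (@to_sphere n r @^-1` A).
Proof.
by move=> mA; rewrite -[X in measurable X]setTI; exact: measurable_to_sphere.
Qed.

Lemma sphere_law_sphere :
  P [set X | sqnorm X = 0] = 0%E -> sphere_law (sphere n r) = 1%E.
Proof.
move=> Z0; pose Z : set (n.-tuple R) := [set X | sqnorm X = 0].
have mZ : measurable Z.
  by have := @measurable_sqnorm R n measurableT [set 0] (measurable_set1 0);
    rewrite setTI.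
have PZ : P (~` Z) = 1%E by rewrite probability_setC// Z0 sube0.
have mS : measurable (sphere n r : set (n.-tuple R)).
  exact: measurable_sphere.
apply/eqP; rewrite eq_le probability_le1//= -PZ.
apply: le_measure; rewrite ?inE; first exact: measurableC.
- exact: measurable_to_sphere_preimage.
- by move=> X /eqP X0; apply/(sphereP r0); exact: sqnorm_to_sphere.
Qed.

(** Whether the normalized [X] lies in a cap about [x] depends only on [(<x, X>, |X|^2)], the pair
    treated by [gaussian_dot]. *)
Definition cap_cone (c : R) : set (R * R) :=
  [set q | c < r / Num.sqrt q.2 * q.1].

Lemma measurable_cap_cone c : measurable (cap_cone c).
Proof.
rewrite -[X in measurable X]setTI.
have mf : measurable_fun setT (fun q : R * R => r / Num.sqrt q.2 * q.1).
  apply: measurable_funM => //; apply: measurable_funM => //.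
  apply: (measurableT_comp measurable_inv).
  exact: (measurableT_comp measurable_sqrt).
by apply: (measurable_fun_ltr (measurable_cst c) mf measurableT (Y := [set true])).
Qed.

Lemma to_sphere_cap x c (X : n.-tuple R) :
  cap x c (to_sphere r X) <-> cap_cone c (dot x X, sqnorm X).
Proof. by rewrite /cap /cap_cone /= dot_scale. Qed.

Lemma sphere_law_cap x c : sphere_law (cap x c) =
  (\int[P]_X (\1_(cap_cone c) (dot x X, sqnorm X))%:E)%E.
Proof.
have mC := measurable_to_sphere_preimage (measurable_cap x c).
transitivity (\int[P]_X (\1_(to_sphere r @^-1` cap x c) X)%:E)%E.
  by rewrite (integral_indic _ measurableT mC) setIT.
apply: eq_integral => X _; rewrite !indicE; congr ((nat_of_bool _)%:R)%:E.
by apply/idP/idP => /set_mem h; apply/mem_set/to_sphere_cap.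
Qed.

Lemma sphere_law_ge (A B : set (n.-tuple R)) :
  measurable A -> measurable B -> (forall X, A X -> B (to_sphere r X)) ->
  (P A <= sphere_law B)%E.
Proof.
move=> mA mB AB; apply: le_measure; rewrite ?inE//.
exact: measurable_to_sphere_preimage.
Qed.

Lemma integral_le_sphere_law (sigma : probability (n.-tuple R) R)
    (F : n.-tuple R -> \bar R) :
  (forall A, measurable A -> sigma A = sphere_law A) ->
  measurable_fun setT F -> (forall x, (0 <= F x)%E) ->
  (\int[sigma]_(x in sphere n r) F x <= \int[P]_X F (to_sphere r X))%E.
Proof.
move=> sE mF F0.
apply: (@le_trans _ _ (\int[sigma]_x F x)%E).
  by apply: ge0_subset_integral => //; exact: measurable_sphere.
rewrite (@eq_measure_integral _ _ _ _ sphere_law sigma F); last first.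
  by move=> A mA _; exact: sE.
by rewrite ge0_integral_distribution.
Qed.

End sphere_law.

Section direction_law.
Variables (n : nat) (r : R).
Hypothesis r0 : 0 < r.
Local Notation gaussian_direction := (sphere_law r (G n.+2)).

Definition direction_cap_mass (c : R) : \bar R :=
  (\int[N01]_a \int[G n.+1]_Z
     (\1_(cap_cone r c) (r * a, a ^+ 2 + sqnorm Z))%:E)%E.

Lemma gaussian_direction_cap x c : sphere n.+2 r x ->
  gaussian_direction (cap x c) = direction_cap_mass c.
Proof.
move=> /(sphereP r0) xr.
pose F (q : R * R) : \bar R := (\1_(cap_cone r c) q)%:E.
have mF : measurable_fun setT F.
  by apply/measurable_EFinP/measurable_indic; exact: measurable_cap_cone.
have F0 q : (0 <= F q)%E by rewrite lee_fin.
rewrite sphere_law_cap -/(direction_cap_mass c).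
by rewrite (gaussian_dot x mF F0) xr sqrtr_sqr gtr0_norm.
Qed.

(** For the centre [r e_0], a box of positive Gaussian mass is sent into the cap: its first
    coordinate exceeds 1 and the others are small. *)
Lemma direction_cap_mass_gt0 c : c < r ^+ 2 -> (0 < direction_cap_mass c)%E.
Proof.
move=> cr; pose x : n.+2.-tuple R := [tuple if i == ord0 then r else 0 | i < n.+2].
have xr : sphere n.+2 r x.
  apply/(sphereP r0); rewrite /sqnorm (bigD1 ord0)//= big1 ?addr0.
    by rewrite tnth_mktuple eqxx.
  by move=> i i0; rewrite tnth_mktuple (negbTE i0) expr0n.
have dotx X : dot x X = r * tnth X ord0.
  rewrite /dot (bigD1 ord0)//= big1 ?addr0; first by rewrite tnth_mktuple eqxx.
  by move=> i i0; rewrite tnth_mktuple (negbTE i0) mul0r.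
rewrite -(gaussian_direction_cap c xr).
(* A nonnegative threshold, so that the inequality defining the cap can be squared. *)
pose c' := Num.max c 0.
have c'0 : 0 <= c' by rewrite le_max lexx orbT.
have c'r : c' < r ^+ 2 by rewrite gt_max cr exprn_gt0.
pose D := r ^+ 2 ^+ 2 - c' ^+ 2.
have D0 : 0 < D by rewrite subr_gt0 ltrXn2r// nnegrE ltW// exprn_gt0.
pose N : R := n.+1%:R.
(* The goal is [c'^2 (1 + N d^2) < r^4], that is [N c'^2 d^2 < D]. The added 1 makes the inequality
   strict and the denominator positive. *)
pose d2 := D / (N * c' ^+ 2 + 1).
have den0 : 0 < N * c' ^+ 2 + 1 by rewrite ltr_wpDl// mulr_ge0// sqr_ge0.
have d20 : 0 < d2 by rewrite divr_gt0.
pose d := Num.sqrt d2.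
have d0 : 0 < d by rewrite sqrtr_gt0.
have dE : d ^+ 2 = d2 by rewrite sqr_sqrtr// ltW.
have d2P : c' ^+ 2 * (1 + N * d2) < r ^+ 2 ^+ 2.
  have : d2 * (N * c' ^+ 2 + 1) = D by rewrite divfK// gt_eqF.
  by rewrite /D; move: d20; nra.
pose A (i : 'I_n.+2) : set R := if i == ord0 then `]1, 2[%classic else `](- d), d[%classic.
have mA i : measurable (A i) by rewrite /A; case: ifP.
pose box : set (n.+2.-tuple R) := [set X | forall i, A i (tnth X i)].
have box0 : (0 < G n.+2 box)%E.
  rewrite std_gaussian_box//.
  elim/big_ind : _ => //.
  - by move=> a b a0 b0; rewrite mule_gt0.
  - move=> i _; rewrite /A; case: ifP => _; apply: normal_prob_itv_gt0.
      by rewrite ltr1n.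
    by rewrite gtrN.
apply: (lt_le_trans box0).
apply: sphere_law_ge; [|exact: measurable_cap|].
  rewrite (_ : box = \bigcap_(i in [set: 'I_n.+2]) (@tnth _ R ^~ i @^-1` A i)).
    apply: fin_bigcap_measurable => // i _.
    by rewrite -[X in measurable X]setTI; exact: measurable_tnth.
  by apply/seteqP; split => X /= h i; [move=> _|]; exact: h.
move=> X boxX; rewrite /cap /= dot_scale dotx.
have := boxX ord0; rewrite /A eqxx /= in_itv/= => /andP[X1 _].
have X0 : 0 < tnth X ord0 by rewrite (lt_trans ltr01).
set q := sqnorm X.
(* As [X_0 > 1], the term [N d^2] may be multiplied by [X_0^2], which then cancels from the cap
   inequality. *)
have q_le : q <= tnth X ord0 ^+ 2 * (1 + N * d2).
  rewrite /q /sqnorm big_ord_recl mulrDr mulr1 lerD2l.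
  apply: (@le_trans _ _ (N * d2)); last first.
    rewrite ler_peMl//; first by rewrite mulr_ge0// ltW.
    by rewrite -[leLHS](expr1n _ 2) lerXn2r// ?nnegrE// ltW.
  rewrite /N -[X in X%:R](card_ord n.+1) mulr_natl -sumr_const.
  apply: ler_sum => i _; rewrite -dE.
  have := boxX (lift ord0 i); rewrite /A /= in_itv/= => /andP[h1 h2].
  by rewrite -[leLHS]real_normK ?num_real// lerXn2r ?nnegrE ?(ltW d0)// ler_norml !ltW.
have q0 : 0 < q.
  apply: (@lt_le_trans _ _ (tnth X ord0 ^+ 2)); first by rewrite exprn_gt0.
  by rewrite /q /sqnorm big_ord_recl lerDl; apply: sumr_ge0 => i _; exact: sqr_ge0.
have sq0 : 0 < Num.sqrt q by rewrite sqrtr_gt0.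
apply: (@le_lt_trans _ _ c'); first by rewrite le_max lexx.
rewrite mulrAC ltr_pdivlMr//.
rewrite -(ltr_pXn2r (n := 2))// ?nnegrE; last 2 first.
- by rewrite mulr_ge0// ltW.
- by rewrite !mulr_ge0// ltW.
rewrite exprMn sqr_sqrtr ?(ltW q0)//.
apply: (@le_lt_trans _ _ (c' ^+ 2 * (tnth X ord0 ^+ 2 * (1 + N * d2)))).
  by rewrite ler_wpM2l// sqr_ge0.
have -> : (r * (r * tnth X ord0)) ^+ 2 = tnth X ord0 ^+ 2 * r ^+ 2 ^+ 2 by ring.
by rewrite mulrCA ltr_pM2l// exprn_gt0.
Qed.

(* Both measures are carried by the sphere and give to a cap a mass that does
   not depend on its centre. *)
Lemma uniform_gaussian_direction (sigma : probability (n.+2.-tuple R) R) A :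
  is_uniform_on_sphere r sigma -> measurable A ->
  sigma A = gaussian_direction A.
Proof.
move=> us mA.
have dS := sphere_law_sphere r0 (gaussian_sqnorm_eq0 (ltn0Sn n.+1)).
apply: (sphere_measure_unique r0 us.1 dS _ gaussian_direction_cap
  direction_cap_mass_gt0 mA).
by move=> x c Sx; apply: uniform_cap Sx.
Qed.

Lemma integral_uniform_sphere_le (sigma : probability (n.+2.-tuple R) R)
    (F : n.+2.-tuple R -> \bar R) : is_uniform_on_sphere r sigma ->
  measurable_fun setT F -> (forall x, (0 <= F x)%E) ->
  (\int[sigma]_(x in sphere n.+2 r) F x <=
   \int[G n.+2]_X F (to_sphere r X))%E.
Proof.
move=> us mF F0; apply: integral_le_sphere_law => // A mA.
exact: uniform_gaussian_direction.
Qed.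

End direction_law.
End gaussian_direction.

(** * Bounds on the density of the projection *)

Section density_bounds.
Context {R : realType}.
Local Notation G := (std_gaussian R).

Lemma bernoulli_ge (x : R) n : 0 <= x <= 1 -> 1 - n%:R * x <= (1 - x) ^+ n.
Proof.
move=> /andP[x0 x1]; elim: n => [|n IH]; first by rewrite mul0r subr0 expr0.
rewrite exprS; have : 0 <= 1 - x by rewrite subr_ge0.
move=> /ler_wpM2l /(_ _ _ IH); apply: le_trans.
by rewrite -natr1; have := ler0n R n; nra.
Qed.

Lemma sqrt_sub_le (t N : R) : 0 < N ->
  Num.sqrt (1 - t / N) <= expR (- (t / (2 * N))).
Proof.
move=> N0; rewrite -[leRHS]ger0_norm ?expR_ge0// -sqrtr_sqr.
rewrite ler_wsqrtr// expr2 -expRD.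
have -> : - (t / (2 * N)) + - (t / (2 * N)) = - (t / N).
  by field; rewrite gt_eqF.
exact: expR_ge1Dx.
Qed.

Lemma radial_weightSS m (v : R) : 0 < v ->
  radial_weight m.+2 v = Num.sqrt v ^+ m.
Proof.
move=> v0; rewrite /radial_weight -addn2 exprD sqr_sqrtr ?(ltW v0)//.
by rewrite mulfK// gt_eqF.
Qed.

(** For [t < N], [(1 - t / N)^(m / 2) <= e^(- m t / (2 N))], and [1 - m / N = (k + 2) / N] is left
    in the exponent. *)
Lemma sphere_density_le k m (w : k.-tuple R) :
  sphere_density m.+2 (Num.sqrt (k + m.+2)%:R) w <=
  expR (k.+2%:R / (k + m.+2)%:R * sqnorm w / 2).
Proof.
set N := (k + m.+2)%:R; set t := sqnorm w.
have N0 : 0 < N by rewrite ltr0n addnS.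
rewrite /sphere_density -/t sqr_sqrtr ?(ltW N0)//.
have [v0|v0] := leP (1 - t / N) 0.
  by rewrite radial_weight_le0// mul0r expR_ge0.
rewrite radial_weightSS//.
apply: (@le_trans _ _ (expR (- (t / (2 * N))) ^+ m * expR (t / 2))).
  rewrite ler_wpM2r ?expR_ge0// lerXn2r ?nnegrE ?sqrtr_ge0 ?expR_ge0//.
  exact: sqrt_sub_le.
rewrite -expRM_natl -expRD ler_expR le_eqVlt; apply/orP; left; apply/eqP.
have NE : N = k%:R + m%:R + 2 by rewrite /N natrD -addn2 natrD addrA.
have -> : k.+2%:R = N - m%:R by rewrite NE -addn2 natrD; ring.
by field; rewrite gt_eqF.
Qed.

(* [(1 - t / N) e^(t / N) >= 1 - (t / N)^2], and Bernoulli's inequality. *)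
Lemma sphere_density_ge k m (w : k.-tuple R) :
  1 - sqnorm w ^+ 2 / (k + m.+2)%:R <=
  sphere_density m.+2 (Num.sqrt (k + m.+2)%:R) w.
Proof.
pose n := (k + m.+2)%N; rewrite -/n; pose N : R := n%:R; set t := sqnorm w.
have t0 : 0 <= t by exact: sqnorm_ge0.
have N1 : 1 <= N by rewrite ler1n /n addnS.
have N0 : 0 < N by rewrite (lt_le_trans ltr01).
rewrite /sphere_density -/t sqr_sqrtr ?(ltW N0)// -/N.
have [v0|v0] := leP (1 - t / N) 0.
  rewrite radial_weight_le0// mul0r subr_le0 ler_pdivlMr// mul1r.
  by move: v0; rewrite subr_le0 ler_pdivlMr// mul1r; nra.
rewrite radial_weightSS//.
(* [y ^+ n = sqrt (1 - u) ^+ n e^(t / 2)] is at most the density, since [sqrt (1 - u) <= 1] and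
   [m <= n]. As [0 <= y <= 1], a lower bound on [y ^+ 2] also bounds [y]. *)
pose u := t / N; pose y := Num.sqrt (1 - u) * expR (t / (2 * N)).
have u0 : 0 <= u by rewrite divr_ge0// ltW.
have s1 : Num.sqrt (1 - u) <= 1 by rewrite -[leRHS]sqrtr1 ler_wsqrtr// gerBl.
have y0 : 0 <= y by rewrite mulr_ge0 ?expR_ge0.
have y1 : y <= 1.
  have -> : 1 = expR (- (t / (2 * N))) * expR (t / (2 * N)) :> R.
    by rewrite -expRD addNr expR0.
  by rewrite ler_wpM2r ?expR_ge0//; exact: sqrt_sub_le.
have y2 : 1 - u ^+ 2 <= y.
  apply: (@le_trans _ _ (y ^+ 2)); last by rewrite expr2 ler_piMr.
  have -> : y ^+ 2 = (1 - u) * expR u.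
    rewrite /y exprMn sqr_sqrtr ?(ltW v0)// -expRM_natl; congr (_ * expR _).
    by rewrite /u; field; rewrite gt_eqF.
  have := expR_ge1Dx u; move: v0; rewrite -/u => v0 h.
  by apply: (@le_trans _ _ ((1 - u) * (1 + u))); [nra|rewrite ler_wpM2l// ltW].
apply: (@le_trans _ _ (y ^+ n)).
  have u1 : u ^+ 2 <= 1.
    by rewrite expr_le1//; move: v0; rewrite -/u subr_gt0 => /ltW.
  apply: (@le_trans _ _ ((1 - u ^+ 2) ^+ n)).
    apply: le_trans (bernoulli_ge n _); last by rewrite sqr_ge0.
    rewrite le_eqVlt; apply/orP; left; apply/eqP; rewrite -/N /u.
    by field; rewrite gt_eqF.
  by rewrite lerXn2r ?nnegrE// subr_ge0.
rewrite [y ^+ n]exprMn -expRM_natl.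
have -> : n%:R * (t / (2 * N)) = t / 2 by rewrite -/N; field; rewrite gt_eqF.
rewrite ler_wpM2r ?expR_ge0// -/u.
by apply: ler_wiXn2l => //; rewrite /n addnS leqW// addnS leqW// leq_addl.
Qed.

Lemma integral_probability_cst1 d (T : measurableType d) (P : probability T R) :
  (\int[P]_x cst 1 x = 1)%E.
Proof. by rewrite integral_cst// mul1e; exact: probability_setT. Qed.

(** Scaling by [sqrt (1 - b)] turns the integrand, written as a function times [gauss_weight], into
    the constant 1. *)
Lemma integral_gaussian_expR k (b : R) : b < 1 ->
  (\int[G k]_w (expR (b * sqnorm w / 2))%:E =
   ((Num.sqrt (1 - b))^-1 ^+ k)%:E)%E.
Proof.
move=> b1; have c0 : 0 < Num.sqrt (1 - b) by rewrite sqrtr_gt0 subr_gt0.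
pose F (w : k.-tuple R) : \bar R := (expR (- (sqnorm w / 2)))%:E.
have mF : measurable_fun setT F.
  apply/measurable_EFinP; apply: (measurableT_comp (@measurable_expR R)).
  apply: measurable_funN; apply: measurable_funM => //.
  exact: measurable_sqnorm.
have F0 w : (0 <= F w)%E by rewrite lee_fin expR_ge0.
have := integral_weighted_scale c0 mF F0.
have -> : (\int[G k]_x (F x * gauss_weight x) = 1)%E.
  transitivity (\int[G k]_x (cst 1 x))%E.
    by apply: eq_integral => x _; rewrite -EFinM -expRD addNr expR0.
  exact: integral_probability_cst1.
rewrite mule1 => <-; apply: eq_integral => w _.
rewrite /F /gauss_weight sqnorm_scale sqr_sqrtr ?subr_ge0 ?(ltW b1)//.
by rewrite -EFinM -expRD; congr (expR _)%:E; field.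
Qed.

(** [e^(t / 4) = (e^(t / 8))^2 >= (1 + t / 8)^2 >= t^2 / 64]. The exponent has the form of the
    Gaussian integral above with [b = 1 / 2]. *)
Lemma sqr_le_expR (t : R) : 0 <= t -> t ^+ 2 <= 64 * expR (2^-1 * t / 2).
Proof.
move=> t0; have -> : 2^-1 * t / 2 = t / 8 + t / 8 by field.
by rewrite expRD; have := expR_ge1Dx (t / 8); nra.
Qed.

End density_bounds.

(** * The marginal on [R^k] and its [L^q] norm *)

Section sphere_marginal.
Context {R : realType}.
Local Notation G := (std_gaussian R).

Lemma first_coords_scale k n c (x : n.-tuple R) :
  first_coords k (scale_tuple c x) = scale_tuple c (first_coords k x).
Proof.
apply: eq_from_tnth => i; rewrite !tnth_mktuple.
have [ni|ni] := leqP n i; first by rewrite !nth_default ?size_tuple// mulr0.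
by rewrite -!(tnth_nth 0 _ (Ordinal ni)) tnth_mktuple.
Qed.

Lemma integral_uniform_first_coords_le k n r (sigma : probability (n.-tuple R) R)
    (H : k.-tuple R -> \bar R) : (1 < n)%N -> 0 < r ->
  is_uniform_on_sphere r sigma ->
  measurable_fun setT H -> (forall x, (0 <= H x)%E) ->
  (\int[sigma]_(x in sphere n r) H (first_coords k x) <=
   \int[G n]_X H (scale_tuple (r / Num.sqrt (sqnorm X)) (first_coords k X)))%E.
Proof.
case: n sigma => [//|[//|n]] sigma _ r0 us mH H0.
have mF : measurable_fun setT (fun x : n.+2.-tuple R => H (first_coords k x)).
  exact: (measurableT_comp mH (@measurable_first_coords R k n.+2)).
apply: (le_trans (integral_uniform_sphere_le r0 us mF _)) => //.
by under eq_integral do rewrite /to_sphere first_coords_scale.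
Qed.

(** The function [H = 1] gives the normalization, and this makes the factor finite: an infinite one
    would yield 0 or [+oo] instead of 1. *)
Lemma sphere_marginal_le k m : exists2 A : R, 0 <= A &
  (A%:E * \int[G k]_w
     (sphere_density m.+2 (Num.sqrt (k + m.+2)%:R) w)%:E = 1)%E /\
  forall (sigma : probability ((k + m.+2).-tuple R) R)
      (H : k.-tuple R -> \bar R),
    is_uniform_on_sphere (Num.sqrt (k + m.+2)%:R) sigma ->
    measurable_fun setT H -> (forall x, (0 <= H x)%E) ->
  (\int[sigma]_(x in sphere (k + m.+2) (Num.sqrt (k + m.+2)%:R))
     H (first_coords k x) <=
   A%:E * \int[G k]_w
     (H w * (sphere_density m.+2 (Num.sqrt (k + m.+2)%:R) w)%:E))%E.
Proof.
set r := Num.sqrt _.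
have r0 : 0 < r by rewrite sqrtr_gt0 ltr0n addnS.
have [A A0 AE] := @gaussian_projection R k m.+2 r isT r0.
pose f (w : k.-tuple R) := sphere_density m.+2 r w.
have A1 : (A * \int[G k]_w (f w)%:E = 1)%E.
  have := AE (cst 1%E) (measurable_cst _) (fun=> lee01).
  rewrite integral_probability_cst1 => ->.
  by congr (_ * _)%E; apply: eq_integral => w _; rewrite mul1e.
have If0 : (0 <= \int[G k]_w (f w)%:E)%E.
  by apply: integral_ge0 => w _; rewrite lee_fin sphere_density_ge0.
have Afin : A \is a fin_num.
  rewrite ge0_fin_numE// ltey; apply/eqP => Ay; move: A1; rewrite Ay.
  have [->|I0] := eqVneq (\int[G k]_w (f w)%:E)%E 0%E.
    by rewrite mule0 => /eqP; rewrite eqe eq_sym oner_eq0.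
  by rewrite gt0_mulye// lt0e I0.
exists (fine A); rewrite ?fine_ge0// fineK//; split=> // sigma H us mH H0.
rewrite -(AE H mH H0).
by apply: integral_uniform_first_coords_le => //; rewrite addnS ltnS addnS.
Qed.

Lemma Lfun_measurable d (T : measurableType d) (P : probability T R) p
  (g : T -> R) : g \in Lfun P p -> measurable_fun setT g.
Proof. by move=> /sub_Lfun_mfun; rewrite inE. Qed.

Lemma LnormE d (T : measurableType d) (P : probability T R) p (g : T -> R) :
  ('N[P]_p%:E[EFin \o g] =
   (\int[P]_x (`|g x| `^ p)%:E) `^ p^-1)%E.
Proof. by rewrite unlock. Qed.

Lemma conjugate_ge1 (p q : R) : 1 < p -> 0 < q -> p^-1 + q^-1 = 1 -> 1 <= q.
Proof.
move=> p1 q0 pq; rewrite -invf_le1// -pq lerDr invr_ge0.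
by rewrite ltW// (lt_trans ltr01).
Qed.

(** For [b < 1], the Gaussian integral of [e^(b |w|^2 / 2)]. *)
Definition moment_factor k (b : R) : R := (Num.sqrt (1 - b))^-1 ^+ k.

Lemma moment_factor_ge1 k b : 0 <= b -> b < 1 -> 1 <= moment_factor k b.
Proof.
move=> b0 b1; rewrite exprn_ege1// invf_ge1 ?sqrtr_gt0 ?subr_gt0//.
by rewrite -[leRHS]sqrtr1 ler_wsqrtr// gerBl.
Qed.

(** The pointwise bound raised to the power [q] has a convergent integral by the condition on [q].
    The [q]-th root is dropped at the end, as the factor is at least 1. *)
Lemma sphere_density_Lnorm_le k m q : 1 <= q ->
  k.+2%:R * q < (k + m.+2)%:R ->
  ('N[G k]_q%:E[EFin \o sphere_density m.+2 (Num.sqrt (k + m.+2)%:R)] <=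
   (moment_factor k (k.+2%:R * q / (k + m.+2)%:R))%:E)%E.
Proof.
move=> q1 qN; set N : R := (k + m.+2)%:R in qN *; set f := sphere_density _ _.
have q0 : 0 < q by rewrite (lt_le_trans ltr01).
have N0 : 0 < N by rewrite ltr0n addnS.
pose b := k.+2%:R * q / N.
have b0 : 0 <= b by rewrite divr_ge0 ?mulr_ge0// ltW.
have b1 : b < 1 by rewrite ltr_pdivrMr// mul1r.
have f0 w : 0 <= f w by exact: sphere_density_ge0.
have mf : measurable_fun setT f by exact: measurable_sphere_density.
rewrite LnormE.
have ms := @measurable_sqnorm R k.
have le_int : (\int[G k]_w (`|f w| `^ q)%:E <= (moment_factor k b)%:E)%E.
  rewrite -(integral_gaussian_expR k b1); apply: ge0_le_integral => //.
  - apply/measurable_EFinP; apply: (measurableT_comp (@measurable_powR R q)).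
    exact: measurableT_comp.
  - apply/measurable_EFinP; apply: (measurableT_comp (@measurable_expR R)).
    by apply: measurable_funM => //; exact: measurable_funM.
  move=> w _; rewrite lee_fin ger0_norm//.
  apply: (@le_trans _ _ (expR (k.+2%:R / N * sqnorm w / 2) `^ q)).
    rewrite ge0_ler_powR ?nnegrE ?expR_ge0// ?(ltW q0)//.
    exact: sphere_density_le.
  rewrite -expRM ler_expR le_eqVlt; apply/orP; left; apply/eqP.
  by rewrite /b; field; rewrite gt_eqF.
have D1 := moment_factor_ge1 k b0 b1.
apply: (@le_trans _ _ ((moment_factor k b)%:E `^ q^-1)%E).
  apply: gt0_ler_poweR le_int; first by rewrite invr_ge0 ltW.
  - by rewrite in_itv/= leey andbT integral_ge0// => w _; rewrite lee_fin powR_ge0.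
  - by rewrite in_itv/= leey andbT lee_fin (le_trans ler01).
rewrite poweR_EFin lee_fin -[leRHS]powRr1 ?(le_trans ler01)//.
by rewrite ler_powR// invf_le1.
Qed.

End sphere_marginal.

(** * Hoelder's inequality and the size of the constants *)

Section sphere_hoelder.
Context {R : realType}.
Local Notation G := (std_gaussian R).

(** A bound for the Gaussian mean of [|w|^4], obtained from [t^2 <= 64 e^(t / 4)]. *)
Definition normalization_excess k : R := 64 * moment_factor k 2^-1.

Lemma normalization_excess_ge0 k : 0 <= normalization_excess k.
Proof.
rewrite mulr_ge0// (le_trans ler01)// moment_factor_ge1//.
by rewrite invf_lt1// ltr1n.
Qed.

Lemma normalization_le k m (A : R) : 0 <= A ->
  (A%:E * \int[G k]_w
    (sphere_density m.+2 (Num.sqrt (k + m.+2)%:R) w)%:E = 1)%E ->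
  normalization_excess k < (k + m.+2)%:R ->
  A <= (1 - normalization_excess k / (k + m.+2)%:R)^-1.
Proof.
move=> A0; set N : R := (k + m.+2)%:R; set f := sphere_density _ _ => A1 eN.
have N0 : 0 < N by rewrite ltr0n addnS.
have d0 : 0 < 1 - normalization_excess k / N.
  by rewrite subr_gt0 ltr_pdivrMr// mul1r.
have f0 w : 0 <= f w by exact: sphere_density_ge0.
have mf : measurable_fun setT f by exact: measurable_sphere_density.
pose e (w : k.-tuple R) : R := expR (2^-1 * sqnorm w / 2).
have me : measurable_fun setT e.
  apply: (measurableT_comp (@measurable_expR R)).
  apply: measurable_funM => //; apply: measurable_funM => //.
  exact: measurable_sqnorm.
have half1 : 2^-1 < 1 :> R by rewrite invf_lt1// ltr1n.
have c0 : 0 <= 64 / N by rewrite divr_ge0// ltW.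
(* The lower bound on the density, with its negative term moved to the other side so that all
   integrands are nonnegative. *)
have : (\int[G k]_w cst 1 w <=
    \int[G k]_w ((f w)%:E + (64 / N)%:E * (e w)%:E))%E.
  apply: ge0_le_integral => //.
  - by apply: emeasurable_funD; [|apply: emeasurable_funM => //]; exact/measurable_EFinP.
  move=> w _; rewrite -EFinM -EFinD lee_fin -lerBlDr.
  apply: le_trans (sphere_density_ge m w); rewrite -/N lerD2l lerN2.
  rewrite [leRHS]mulrAC ler_wpM2r ?invr_ge0 ?(ltW N0)//.
  by apply: sqr_le_expR; exact: sqnorm_ge0.
rewrite integral_probability_cst1 ge0_integralD//; last 4 first.
- by move=> w _; rewrite lee_fin.
- exact/measurable_EFinP.
- by move=> w _; rewrite -EFinM lee_fin mulr_ge0// expR_ge0.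
- by apply: emeasurable_funM => //; exact/measurable_EFinP.
rewrite ge0_integralTZl; [|exact/measurable_EFinP|by move=> w; rewrite lee_fin expR_ge0|by []].
rewrite integral_gaussian_expR// -EFinM.
rewrite (_ : 64 / N * _ = normalization_excess k / N); last by rewrite mulrAC.
set c := _ / N => h; have c_ge0 : 0 <= c.
  by rewrite divr_ge0 ?normalization_excess_ge0// ltW.
have If0 : (0 <= \int[G k]_w (f w)%:E)%E.
  by apply: integral_ge0 => w _; rewrite lee_fin.
have := @lee_wpmul2l R A%:E A0 _ _ h.
rewrite mule1 ge0_muleDr// A1 -EFinM -EFinD lee_fin => Ac.
by rewrite -[leRHS]mul1r ler_pdivlMr//; move: Ac; lra.
Qed.

Lemma sphere_hoelder k n (p q : R) : 1 < p -> 0 < q -> p^-1 + q^-1 = 1 ->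
  4 * k.+1%:R * q < n%:R ->
  exists2 A : R, 0 <= A & (normalization_excess k < n%:R ->
    A <= (1 - normalization_excess k / n%:R)^-1) /\
  forall (g : k.-tuple R -> R) (sigma : probability (n.-tuple R) R),
    g \in Lfun (std_gaussian R k) p%:E ->
    is_uniform_on_sphere (Num.sqrt n%:R) sigma ->
  (\int[sigma]_(x in sphere n (Num.sqrt n%:R)) `|g (first_coords k x)|%:E
   <= (A * moment_factor k (k.+2%:R * q / n%:R))%:E *
      'E_(std_gaussian R k)[fun y => (`|g y| `^ p)%R] `^ p^-1)%E.
Proof.
move=> p1 q0 pq qn; have q1 := conjugate_ge1 p1 q0 pq.
have p0 : 0 < p by rewrite (lt_trans ltr01).
have k0 : 0 < k.+1%:R :> R by rewrite ltr0n.
(* From [k + 2 <= 4 (k + 1)]; this is the convergence condition for the [q]-th moment. *)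
have knR : k.+2%:R * q < n%:R.
  apply: le_lt_trans qn; rewrite ler_wpM2r ?(ltW q0)//.
  by rewrite -natr1; have : 1 <= k.+1%:R :> R; [rewrite ler1n|lra].
(* Since [1 <= q]. The exponent [(n - k) / 2 - 1] of the density is then nonnegative. *)
have kn : (k.+2 <= n)%N.
  rewrite -(ler_nat R); apply: le_trans (ltW knR).
  by rewrite ler_peMr.
have [m nE] : exists m, n = (k + m.+2)%N.
  by exists (n - k.+2)%N; rewrite !addnS -!addSn subnKC.
subst n; have [A A0 [A1 AE]] := @sphere_marginal_le R k m.
exists A => //; split=> [|g sigma gL us]; first exact: normalization_le.
have mg := Lfun_measurable gL.
have mabs : measurable_fun setT (fun y => `|g y|%:E).
  by apply/measurable_EFinP; exact: measurableT_comp.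
have abs0 y : (0 <= `|g y|%:E)%E by rewrite lee_fin.
apply: le_trans (AE sigma _ us mabs abs0) _.
rewrite EFinM -muleA; apply: lee_wpmul2l; first by rewrite lee_fin.
set f := sphere_density _ _.
have mf : measurable_fun setT f by exact: measurable_sphere_density.
have := hoelder (std_gaussian R k) mg mf p0 q0 pq.
rewrite Lnorm1 LnormE => hl.
rewrite (_ : (\int[G k]_w _)%E = \int[G k]_x `|(EFin \o (g \* f)%R) x|)%E; last first.
  apply: eq_integral => w _; rewrite /= normrM EFinM.
  by rewrite (ger0_norm (sphere_density_ge0 _ _ _)).
have -> : ('E_(std_gaussian R k)[fun y => (`|g y| `^ p)%R] =
    \int[G k]_x (`|g x| `^ p)%:E)%E by rewrite unlock.
apply: (le_trans hl); rewrite muleC.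
apply: lee_wpmul2r; first exact: poweR_ge0.
exact: sphere_density_Lnorm_le.
Qed.

(** The constant is a function [h] of [1 / n] that tends to 1 at 0. *)
Lemma hoelder_constant_near1 k (q eps : R) : 0 < eps ->
  exists N : nat, forall n, (N < n)%N ->
    normalization_excess k < n%:R /\
    (1 - normalization_excess k / n%:R)^-1 *
      moment_factor k (k.+2%:R * q / n%:R) <= 1 + eps.
Proof.
move=> eps0; set e := normalization_excess k.
pose h (u : R) := (1 - e * u)^-1 * (Num.sqrt (1 - k.+2%:R * q * u))^-1 ^+ k.
have u0 : (@harmonic R) n @[n --> \oo] --> (0 : R) by exact: cvg_harmonic.
have lin (c : R) : 1 - c * harmonic n @[n --> \oo] --> (1 : R).
  rewrite -[X in _ --> X]subr0 -(mulr0 c).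
  by apply: cvgB; [exact: cvg_cst|apply: cvgM => //; exact: cvg_cst].
have ch : h (harmonic n) @[n --> \oo] --> (1 : R).
  have -> : 1 = 1^-1 * (Num.sqrt 1)^-1 ^+ k :> R.
    by rewrite sqrtr1 invr1 expr1n mulr1.
  apply: cvgM; first by apply: cvgV; rewrite ?oner_eq0.
  apply: (cvg_comp _ (fun x => x ^+ k)); last exact: exprn_continuous.
  apply: cvgV; first by rewrite sqrtr1 oner_eq0.
  by apply: (cvg_comp _ (@Num.sqrt R)) (lin _) _; exact: sqrt_continuous.
have [N _ hN] : \forall n \near \oo, h (harmonic n) <= 1 + eps.
  by apply: (cvgr_le _ ch); rewrite ltrDl.
(* [harmonic n] is [1 / (n + 1)], so the index [n] stands for the dimension [n + 1]. *)
exists (maxn N (Num.truncn e).+1) => -[//|n]; rewrite gtn_max !ltnS => /andP[Nn en].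
split.
  apply: lt_le_trans (truncnS_gt e) _; rewrite ler_nat.
  by rewrite (leq_trans en).
exact: hN.
Qed.

End sphere_hoelder.

Definition sphere_bound {R : realType} k (p C : R) n : Prop :=
  forall g : k.-tuple R -> R, g \in Lfun (std_gaussian R k) p%:E ->
  forall sigma : probability (n.-tuple R) R,
    is_uniform_on_sphere (Num.sqrt n%:R) sigma ->
    (\int[sigma]_(x in sphere n (Num.sqrt n%:R)) `|g (first_coords k x)|%:E
     <= C%:E * 'E_(std_gaussian R k)[fun y => (`|g y| `^ p)%R] `^ p^-1)%E.

Lemma sphere_bound_le {R : realType} k (p C D : R) n : C <= D ->
  sphere_bound k p C n -> sphere_bound k p D n.
Proof.
move=> CD bC g gL sigma us; apply: le_trans (bC g gL sigma us) _.
by apply: lee_wpmul2r; [exact: poweR_ge0|rewrite lee_fin].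
Qed.

Lemma sphere_bound_near1 {R : realType} k (p q eps : R) :
  1 < p -> 0 < q -> p^-1 + q^-1 = 1 -> 0 < eps ->
  exists N : nat, forall n, (N < n)%N -> 4 * k.+1%:R * q < n%:R ->
    sphere_bound k p (1 + eps) n.
Proof.
move=> p1 q0 pq eps0; have [N hN] := hoelder_constant_near1 k q eps0.
exists N => n /hN[en le_eps] qn.
have [A A0 [Ale AE]] := sphere_hoelder p1 q0 pq qn.
apply: (@sphere_bound_le _ _ _ (A * moment_factor k (k.+2%:R * q / n%:R))).
  apply: le_trans le_eps; rewrite ler_wpM2r ?Ale//.
  by rewrite exprn_ge0// invr_ge0 sqrtr_ge0.
by move=> g gL sigma us; exact: AE.
Qed.

Theorem theorem1p3 (R : realType) (k : nat) :
  (forall p q : R, 1 < p -> 0 < q -> p^-1 + q^-1 = 1 ->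
    exists2 C : R, 0 < C &
      forall (g : k.-tuple R -> R), g \in Lfun (std_gaussian R k) p%:E ->
      forall n : nat, 4 * (k.+1)%:R * q < n%:R ->
      forall sigma : probability (n.-tuple R) R,
        is_uniform_on_sphere (Num.sqrt n%:R) sigma ->
        (\int[sigma]_(x in sphere n (Num.sqrt n%:R)) `|g (first_coords k x)|%:E
         <= C%:E * 'E_(std_gaussian R k)[fun y => (`|g y| `^ p)%R] `^ p^-1)%E)
  /\
  (forall p eps : R, 1 < p -> 0 < eps ->
    exists np : nat,
      forall (g : k.-tuple R -> R), g \in Lfun (std_gaussian R k) p%:E ->
      forall n : nat, (np < n)%N ->
      forall sigma : probability (n.-tuple R) R,
        is_uniform_on_sphere (Num.sqrt n%:R) sigma ->
        (\int[sigma]_(x in sphere n (Num.sqrt n%:R)) `|g (first_coords k x)|%:E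
         <= (1 + eps)%:E *
            'E_(std_gaussian R k)[fun y => (`|g y| `^ p)%R] `^ p^-1)%E).
Proof.
split=> [p q p1 q0 pq|p eps p1 eps0]; last first.
  pose q := p / (p - 1).
  have p0 : 0 < p by rewrite (lt_trans ltr01).
  have q0 : 0 < q by rewrite divr_gt0// subr_gt0.
  have pq : p^-1 + q^-1 = 1.
    by rewrite /q; field; rewrite !gt_eqF// subr_gt0.
  have [N hN] := sphere_bound_near1 k p1 q0 pq eps0.
  (* The second bound provides the condition [4 (k + 1) q < n] under which the estimate is
     available. *)
  exists (maxn N (Num.truncn (4 * k.+1%:R * q)).+1) => g gL n.
  rewrite gtn_max => /andP[Nn qn] sigma us.
  apply: hN => //; apply: lt_le_trans (truncnS_gt _) _.
  by rewrite ler_nat ltnW.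
have [N hN] := sphere_bound_near1 k p1 q0 pq ltr01.
(* A constant for each dimension separately, set to 0 where the condition on [n] fails. *)
have /choice[C CP] n : exists C : R,
    0 <= C /\ (4 * k.+1%:R * q < n%:R -> sphere_bound k p C n).
  have [qn|qn] := ltP (4 * k.+1%:R * q) (n%:R : R); last first.
    by exists 0; split=> //; rewrite ltNge qn.
  have [A A0 [_ AE]] := sphere_hoelder p1 q0 pq qn.
  exists (A * moment_factor k (k.+2%:R * q / n%:R)); split.
    by rewrite mulr_ge0// exprn_ge0// invr_ge0 sqrtr_ge0.
  by move=> _ g gL sigma us; exact: AE.
have sumC0 : 0 <= \sum_(i < N.+1) C i by apply: sumr_ge0 => i _; exact: (CP i).1.
(* One constant for all [n]: 2 is the bound [1 + eps] with [eps = 1] beyond [N], and the sum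
   dominates the constants of the dimensions up to [N]. *)
exists (2 + \sum_(i < N.+1) C i); first by rewrite ltr_wpDr.
move=> g gL n qn sigma us; have [Nn|nN] := ltnP N n.
  apply: (sphere_bound_le _ (hN n Nn qn)) => //.
  by rewrite lerDl.
apply: (sphere_bound_le _ ((CP n).2 qn)) => //.
rewrite -ltnS in nN; rewrite (bigD1 (Ordinal nN))//= addrCA lerDl.
by rewrite addr_ge0// sumr_ge0// => i _; exact: (CP i).1.
Qed.
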